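(* Let $n \geq 3$ be an integer, let $S_+^n = \{x \in S^n \subset \mathbb{R}^{n+1} : x_{n+1} \geq 0\}$ be the closed upper hemisphere, and let $\overline{g}$ denote the standard (round) metric on $S_+^n$. Then there exists a smooth Riemannian metric $g$ on $S_+^n$ with the following properties: (i) the scalar curvature of $g$ is strictly greater than $n(n-1)$ at every point of $S_+^n$; (ii) at each point of $\partial S_+^n$ we have $g - \overline{g} = 0$ (as bilinear forms on the full tangent space of $S_+^n$); (iii) the mean curvature of $\partial S_+^n$ with respect to $g$ is strictly positive, i.e. the mean curvature vector of $\partial S_+^n$ with respect to $g$ is inward-pointing.
   Context: Mean curvature convention: for a metric $g$, the mean curvature vector of the boundary is $-H_g\,\nu_g$, where $\nu_g$ is the outward-pointing unit normal; so $H_g > 0$ means the mean curvature vector points into the manifold. *)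

(* Defs.v *)
(* The closed upper hemisphere S^n_+ is described in the
   global chart given by stereographic projection from the south pole, which is a
   diffeomorphism of S^n_+ onto the closed unit ball of R^n. *)
From HB Require Import structures.
From mathcomp Require Import all_boot all_order all_algebra.
From mathcomp Require Import all_classical all_reals all_analysis.
Set Implicit Arguments. Unset Strict Implicit. Unset Printing Implicit Defensive.
Import Order.TTheory GRing.Theory Num.Theory.
Import numFieldNormedType.Exports.
Local Open Scope classical_set_scope.
Local Open Scope ring_scope.

Section Geom.
Context {R : realType} {n : nat}.
Local Notation V := 'rV[R]_n.

Definition ebasis (i : 'I_n) : V := delta_mx 0 i.
Definition pd (i : 'I_n) (f : V -> R) : V -> R := fun x => 'D_(ebasis i) f x.
Definition iter_pd (s : seq 'I_n) (f : V -> R) : V -> R := foldr pd f s.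

Definition smooth_on (U : set V) (f : V -> R) : Prop :=
  forall (s : seq 'I_n) (x : V), U x ->
    {for x, continuous (iter_pd s f)} /\
    forall i, derivable (iter_pd s f) x (ebasis i).

Definition sqnorm (y : V) : R := \sum_i y 0 i ^+ 2.
Definition closed_ball1 : set V := [set y | sqnorm y <= 1].
Definition unit_sphere : set V := [set y | sqnorm y = 1].

Definition metric_field := 'I_n -> 'I_n -> V -> R.

Definition gmx (g : metric_field) (x : V) : 'M[R]_n := \matrix_(i, j) g i j x.
Definition ginv (g : metric_field) (x : V) (i j : 'I_n) : R := invmx (gmx g x) i j.

(* smooth Riemannian metric on the closed ball (= on S^n_+): smooth up to the
   boundary (restriction of a smooth field on an open neighbourhood), symmetric,
   positive definite *)
Definition smooth_metric_on_closed_ball (g : metric_field) : Prop :=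
  (exists U : set V, open U /\ closed_ball1 `<=` U /\
     forall i j, smooth_on U (g i j)) /\
  (forall x, closed_ball1 x -> forall i j, g i j x = g j i x) /\
  (forall x, closed_ball1 x -> forall v : V, v != 0 ->
     0 < \sum_i \sum_j v 0 i * v 0 j * g i j x).

Definition christ (g : metric_field) (k i j : 'I_n) (x : V) : R :=
  2^-1 * \sum_l ginv g x k l * (pd i (g j l) x + pd j (g i l) x - pd l (g i j) x).

Definition ricci (g : metric_field) (i j : 'I_n) (x : V) : R :=
  \sum_k (pd k (christ g k i j) x - pd j (christ g k i k) x) +
  \sum_k \sum_l (christ g k k l x * christ g l i j x
                 - christ g k j l x * christ g l i k x).

Definition scal (g : metric_field) (x : V) : R :=
  \sum_i \sum_j ginv g x i j * ricci g i j x.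

(* round metric of S^n_+ in stereographic coordinates: 4/(1+|y|^2)^2 delta_ij *)
Definition gbar : metric_field :=
  fun i j y => (i == j)%:R * (4 / (1 + sqnorm y) ^+ 2).

(* outward g-unit normal to the level sets of |y|^2 (components nu^k) *)
Definition nu (g : metric_field) (k : 'I_n) (x : V) : R :=
  (\sum_j ginv g x k j * pd j sqnorm x) /
  Num.sqrt (\sum_i \sum_j ginv g x i j * pd i sqnorm x * pd j sqnorm x).

(* mean curvature of {|y| = 1} w.r.t. outward normal: trace over the tangent
   space of the second fundamental form h(X,Y) = g(nabla_X nu, Y), i.e.
   H = (g^ij - nu^i nu^j) g_jk (d_i nu^k + Gamma^k_il nu^l).
   With this sign convention the mean curvature vector is -H nu. *)
Definition mean_curv (g : metric_field) (x : V) : R :=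
  \sum_i \sum_j (ginv g x i j - nu g i x * nu g j x) *
    \sum_k g j k x * (pd i (nu g k) x + \sum_l christ g k i l x * nu g l x).

End Geom.

(* Main.v *)
(* The metric is induced on the hemisphere by a spacelike hypersurface of de Sitter space
   close to the totally geodesic sphere.  The normal being timelike, the Gauss equation
   reads scal = n (n - 1) + tr (W^2) - (tr W)^2 for the Weingarten map W.
   The hypersurface is built from a function tau on the sphere in such a way that, with
   A = Hess tau + tau id, one has exactly W = eps kappa (1 - s A)^-1 A, where s is a small
   multiple of the height z.  As s = 0 on the equator, the metric (1 - s A)^2 gbar is
   round there, and the mean curvature of the equator is eps kappa times the trace of A
   over its tangent space.  So it suffices that tr (A^2) > (tr A)^2 on the hemisphere,
   which persists for small eps by compactness, and that this last trace is positive.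
   Both hold for tau = L (1 + d^2 - xi^2 + 2 d z), with xi a coordinate, L' (v) = v^-a,
   a slightly above n / 4, d small and a suitable integration constant C in L. *)
Require Import Defs.
From HB Require Import structures.
From mathcomp Require Import all_boot all_order all_algebra.
From mathcomp Require Import all_classical all_reals all_analysis.
From mathcomp Require Import ring lra.
Import Order.TTheory GRing.Theory Num.Theory.
Import numFieldNormedType.Exports.
Local Open Scope classical_set_scope.
Local Open Scope ring_scope.

Set Implicit Arguments. Unset Strict Implicit. Unset Printing Implicit Defensive.

(** * Functions built by arithmetic and real powers *)

(** A change of the metric that vanishes on the equator cannot raise the scalar curvature everywhere
    to first order: z lies in the kernel of the adjoint of the linearized scalar curvature, so the
    first variation times z integrates to 0. Here the first variation vanishes identically, and the
    gain is of order eps^2. For d = 0, tau depends on xi alone, and v^a A has the eigenvalue l with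
    multiplicity n - 1 and the eigenvalue l - m, where m = 4 a xi^2 + 2 (1 - xi^2). The curvature
    condition reads 0 < l < 2 m / n, the boundary condition m / (n - 1) < l; the two are compatible
    exactly when n >= 3. Near the points xi = 1 and xi = -1 of the equator, v -> 0, l -> 2 and m ->
    4 a, which leaves n / 4 <= a <= (n - 1) / 2. As tau is not smooth at these points, d > 0 moves
    the singularities to z = - d, just outside the hemisphere, at the cost of errors of order d. *)

Section Elementary.
Context {R : realType} {n : nat}.
Local Notation V := 'rV[R]_n.
Implicit Types (U : set V) (f g : V -> R) (x : V) (i j : 'I_n).

(** A syntactic class that contains all functions in play and is closed under [pd]: smoothness and
    the symmetry of second derivatives become inductions on the construction. The domain [U] records
    where inverses and powers are legitimate. *)
Inductive term U : (V -> R) -> Prop :=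
| term_cst c : term U (fun=> c)
| term_coord i : term U (fun y => y 0 i)
| term_add f g : term U f -> term U g -> term U (fun y => f y + g y)
| term_mul f g : term U f -> term U g -> term U (fun y => f y * g y)
| term_inv f : term U f -> (forall x, U x -> f x != 0) -> term U (fun y => (f y)^-1)
| term_powR f r : term U f -> (forall x, U x -> 0 < f x) ->
    term U (fun y => f y `^ r).

(** Agreement on [U] only: the entries of an inverse matrix, for instance, are given by a term only
    where the determinant is nonzero. *)
Definition elem U f := exists2 g, term U g & forall x, U x -> f x = g x.

Lemma near_open U x (P : V -> Prop) :
  open U -> U x -> (forall y, U y -> P y) -> \forall y \near x, P y.
Proof. by move=> oU Ux UP; apply: filterS UP _; exact: open_nbhs_nbhs. Qed.

Lemma differentiable_powR f x r :
  0 < f x -> differentiable f x -> differentiable (fun y => f y `^ r) x.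
Proof.
move=> f0 df; apply: (differentiable_comp (g := fun t => t `^ r)) => //.
by apply/derivable1_diffP; have [] := is_derive1_powR r f0.
Qed.

Lemma term_differentiable U f x : term U f -> U x -> differentiable f x.
Proof.
move=> Ef; elim: Ef x => {f}.
- by move=> c x _; exact: differentiable_cst.
- by move=> i x _; exact: differentiable_coord.
- by move=> f g _ df _ dg x Ux; exact: (differentiableD (df x Ux) (dg x Ux)).
- by move=> f g _ df _ dg x Ux; exact: (differentiableM (df x Ux) (dg x Ux)).
- by move=> f _ df f0 x Ux; apply: differentiableV; [exact: df|exact: f0].
- by move=> f r _ df f0 x Ux; apply: differentiable_powR; [exact: f0|exact: df].
Qed.

Lemma elem_derivable U f x v : open U -> elem U f -> U x -> derivable f x v.
Proof.
move=> oU [g Eg fg] Ux.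
have dg : derivable g x v by apply: diff_derivable; exact: term_differentiable Eg Ux.
have gf : \forall y \near x, g y = f y by apply: near_open oU Ux _ => y /fg.
by have [] := near_eq_is_derive gf (derivableP dg).
Qed.

Lemma elem_continuous U f x : open U -> elem U f -> U x -> {for x, continuous f}.
Proof.
move=> oU [g Eg fg] Ux; rewrite /prop_for /continuous_at fg//.
apply: cvg_trans (differentiable_continuous (term_differentiable Eg Ux)).
have gf : \forall y \near x, g y = f y by apply: near_open oU Ux _ => y /fg.
exact: (near_eq_cvg gf).
Qed.

Lemma pd_ext U f g x i :
  open U -> U x -> (forall y, U y -> f y = g y) -> pd i f x = pd i g x.
Proof. by move=> oU Ux fg; apply: near_eq_derive; exact: near_open oU Ux fg. Qed.

Lemma pd_cst c x i : pd i (fun=> c) x = 0.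
Proof. exact: derive_cst. Qed.

Lemma pd_coord x i j : pd i (fun y => y 0 j) x = (i == j)%:R.
Proof.
rewrite /pd deriveE; last exact: differentiable_coord.
have @f : {linear V -> R}.
  by exists (fun N : V => N 0 j); do 2![eexists]; do ?[constructor];
     rewrite ?mxE// => ? *; rewrite ?mxE//; move=> ?; rewrite !mxE.
rewrite (_ : (fun _ => _) = f) // diff_lin; last exact: coord_continuous.
by rewrite /f/= mxE eqxx eq_sym.
Qed.

Lemma pdD f g x i : derivable f x (ebasis i) -> derivable g x (ebasis i) ->
  pd i (fun y => f y + g y) x = pd i f x + pd i g x.
Proof. exact: deriveD. Qed.

Lemma pdM f g x i : derivable f x (ebasis i) -> derivable g x (ebasis i) ->
  pd i (fun y => f y * g y) x = f x * pd i g x + g x * pd i f x.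
Proof. exact: deriveM. Qed.

Lemma pdV f x i : f x != 0 -> derivable f x (ebasis i) ->
  pd i (fun y => (f y)^-1) x = - (f x) ^- 2 * pd i f x.
Proof. exact: deriveV. Qed.

Lemma pd_powR f x r i : 0 < f x -> differentiable f x ->
  pd i (fun y => f y `^ r) x = r * f x `^ (r - 1) * pd i f x.
Proof.
move=> f0 df; have dr := is_derive1_powR r f0.
have drd : differentiable (fun t : R => t `^ r) (f x).
  by apply/derivable1_diffP; have [] := dr.
rewrite /pd deriveE; last exact: differentiable_powR.
rewrite (diff_comp (g := fun t : R => t `^ r)) //= diff1E//= derive1E -deriveE//.
by rewrite (derive_val (is_derive := dr)) -[LHS]/(_ * _) mulrC.
Qed.

Lemma elem_cst U c : elem U (fun=> c).
Proof. by exists (fun=> c) => //; exact: term_cst. Qed.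

Lemma elem_coord U i : elem U (fun y => y 0 i).
Proof. by exists (fun y => y 0 i) => //; exact: term_coord. Qed.

Lemma elemD U f g : elem U f -> elem U g -> elem U (fun y => f y + g y).
Proof.
move=> [f' Ef ff] [g' Eg gg]; exists (fun y => f' y + g' y); first exact: term_add.
by move=> x Ux; rewrite ff// gg.
Qed.

Lemma elemM U f g : elem U f -> elem U g -> elem U (fun y => f y * g y).
Proof.
move=> [f' Ef ff] [g' Eg gg]; exists (fun y => f' y * g' y); first exact: term_mul.
by move=> x Ux; rewrite ff// gg.
Qed.

Lemma elemV U f : elem U f -> (forall x, U x -> f x != 0) -> elem U (fun y => (f y)^-1).
Proof.
move=> [f' Ef ff] f0; exists (fun y => (f' y)^-1); last by move=> x /ff ->.
by apply: term_inv => // x Ux; rewrite -ff// f0.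
Qed.

Lemma elem_powR U f r : elem U f -> (forall x, U x -> 0 < f x) ->
  elem U (fun y => f y `^ r).
Proof.
move=> [f' Ef ff] f0; exists (fun y => f' y `^ r); last by move=> x /ff ->.
by apply: term_powR => // x Ux; rewrite -ff// f0.
Qed.

Lemma elem_ext U f g : elem U g -> (forall x, U x -> f x = g x) -> elem U f.
Proof. by move=> [h Eh gh] fg; exists h => // x Ux; rewrite fg// gh. Qed.

Lemma elemN U f : elem U f -> elem U (fun y => - f y).
Proof.
move=> Ef; apply: elem_ext (elemM (elem_cst U (-1)) Ef) _ => x _.
by rewrite mulN1r.
Qed.

Lemma elemB U f g : elem U f -> elem U g -> elem U (fun y => f y - g y).
Proof. by move=> Ef Eg; apply: elemD => //; exact: elemN. Qed.

Lemma elemX U f k : elem U f -> elem U (fun y => f y ^+ k).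
Proof.
move=> Ef; elim: k => [|k IH]; first exact: (elem_cst U 1).
by apply: elem_ext (elemM Ef IH) _ => x _; rewrite exprS.
Qed.

Lemma elem_sum U (I : Type) (r : seq I) (P : pred I) (F : I -> V -> R) :
  (forall k, elem U (F k)) -> elem U (fun y => \sum_(k <- r | P k) F k y).
Proof.
move=> EF; elim: r => [|k r IH].
  by apply: elem_ext (elem_cst U 0) _ => x _; rewrite big_nil.
case Pk : (P k); last by apply: elem_ext IH _ => x _; rewrite big_cons Pk.
by apply: elem_ext (elemD (EF k) IH) _ => x _; rewrite big_cons Pk.
Qed.

Lemma elem_prod U (I : Type) (r : seq I) (P : pred I) (F : I -> V -> R) :
  (forall k, elem U (F k)) -> elem U (fun y => \prod_(k <- r | P k) F k y).
Proof.
move=> EF; elim: r => [|k r IH].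
  by apply: elem_ext (elem_cst U 1) _ => x _; rewrite big_nil.
case Pk : (P k); last by apply: elem_ext IH _ => x _; rewrite big_cons Pk.
by apply: elem_ext (elemM (EF k) IH) _ => x _; rewrite big_cons Pk.
Qed.

Lemma elem_subset U U' f : U' `<=` U -> elem U f -> elem U' f.
Proof.
move=> sU [g Eg fg]; suff Eg' : elem U' g by apply: elem_ext Eg' _ => x /sU /fg.
elim: Eg => {f g fg}.
- exact: elem_cst.
- exact: elem_coord.
- by move=> f g _ Ef _ Eg; exact: elemD.
- by move=> f g _ Ef _ Eg; exact: elemM.
- by move=> f _ Ef f0; apply: elemV => // x /sU /f0.
- by move=> f r _ Ef f0; apply: elem_powR => // x /sU /f0.
Qed.

Section PdRules.
Variables (U : set V) (oU : open U).

Lemma elem_pdD f g x i : elem U f -> elem U g -> U x ->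
  pd i (fun y => f y + g y) x = pd i f x + pd i g x.
Proof. by move=> Ef Eg Ux; apply: pdD; exact: elem_derivable oU _ Ux. Qed.

Lemma elem_pdM f g x i : elem U f -> elem U g -> U x ->
  pd i (fun y => f y * g y) x = f x * pd i g x + g x * pd i f x.
Proof. by move=> Ef Eg Ux; apply: pdM; exact: elem_derivable oU _ Ux. Qed.

Lemma elem_pdV f x i : elem U f -> f x != 0 -> U x ->
  pd i (fun y => (f y)^-1) x = - (f x) ^- 2 * pd i f x.
Proof. by move=> Ef f0 Ux; apply: pdV => //; exact: elem_derivable oU _ Ux. Qed.

Lemma elem_pd_powR f x r i : elem U f -> (forall x, U x -> 0 < f x) -> U x ->
  pd i (fun y => f y `^ r) x = r * f x `^ (r - 1) * pd i f x.
Proof.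
move=> [g Eg fg] f0 Ux.
rewrite (pd_ext (g := fun y => g y `^ r) i oU Ux) => [|y /fg -> //].
rewrite (pd_ext (f := f) i oU Ux fg) pd_powR ?fg//; first by rewrite -fg// f0.
exact: term_differentiable Eg Ux.
Qed.

Lemma elem_pdN f x i : elem U f -> U x -> pd i (fun y => - f y) x = - pd i f x.
Proof. by move=> Ef Ux; apply: deriveN; exact: elem_derivable oU Ef Ux. Qed.

Lemma elem_pdB f g x i : elem U f -> elem U g -> U x ->
  pd i (fun y => f y - g y) x = pd i f x - pd i g x.
Proof. by move=> Ef Eg Ux; rewrite elem_pdD ?elem_pdN//; exact: elemN. Qed.

Lemma elem_pd_sum (I : Type) (r : seq I) (F : I -> V -> R) x i :
  (forall k, elem U (F k)) -> U x ->
  pd i (fun y => \sum_(k <- r) F k y) x = \sum_(k <- r) pd i (F k) x.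
Proof.
move=> EF Ux; elim: r => [|k r IH].
  rewrite big_nil (pd_ext (g := fun=> 0) i oU Ux) ?pd_cst// => y _.
  by rewrite big_nil.
rewrite big_cons -IH -elem_pdD//; last exact: elem_sum.
by apply: (pd_ext i oU Ux) => y _; rewrite big_cons.
Qed.

(** Reduces [smooth_on], which quantifies over all iterated partial derivatives, to continuity and
    derivability of a single function of the class. *)
Lemma elem_pd f i : elem U f -> elem U (pd i f).
Proof.
move=> [g Eg fg].
suff Eg' : elem U (pd i g) by apply: elem_ext Eg' _ => x Ux; exact: pd_ext oU Ux fg.
have te h : term U h -> elem U h by move=> th; exists h.
elim: Eg => {f g fg}.
- by move=> c; apply: elem_ext (elem_cst U 0) _ => x _; exact: pd_cst.
- by move=> j; apply: elem_ext (elem_cst U (i == j)%:R) _ => x _; exact: pd_coord.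
- move=> f g /te Tf Ef /te Tg Eg; apply: elem_ext (elemD Ef Eg) _ => x Ux.
  exact: elem_pdD.
- move=> f g /te Tf Ef /te Tg Eg.
  apply: elem_ext (elemD (elemM Tf Eg) (elemM Tg Ef)) _ => x Ux.
  exact: elem_pdM.
- move=> f /te Tf Ef f0; have EV := elemV Tf f0.
  apply: elem_ext (elemM (elemN (elemX 2 EV)) Ef) _ => x Ux.
  by rewrite elem_pdV ?f0// exprVn.
- move=> f r /te Tf Ef f0.
  apply: elem_ext (elemM (elemM (elem_cst U r) (elem_powR (r - 1) Tf f0)) Ef) _.
  by move=> x Ux; rewrite elem_pd_powR.
Qed.

Lemma elem_iter_pd f s : elem U f -> elem U (iter_pd s f).
Proof. by move=> Ef; elim: s => //= i s IH; exact: elem_pd. Qed.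

Lemma elem_smooth f : elem U f -> smooth_on U f.
Proof.
move=> Ef s x Ux; have Es := elem_iter_pd s Ef.
by split=> [|i]; [exact: elem_continuous oU Es Ux|exact: elem_derivable oU Es Ux].
Qed.

(** Schwarz's theorem by induction: it holds for constants and coordinates, and each rule of
    differentiation, applied twice, gives an expression symmetric in [i] and [j] once this is known
    for the constituents. *)
Lemma pdC f i j x : elem U f -> U x -> pd i (pd j f) x = pd j (pd i f) x.
Proof.
move=> [g Eg fg] Ux.
have fgd k y : U y -> pd k f y = pd k g y by move=> Uy; exact: pd_ext oU Uy fg.
rewrite (pd_ext i oU Ux (fgd j)) (pd_ext j oU Ux (fgd i)) {f fg fgd}.
have te h : term U h -> elem U h by move=> th; exists h.
elim: Eg x Ux => {g}.
- move=> c x Ux.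
  rewrite (pd_ext (g := fun=> 0) i oU Ux) => [|y _]; last exact: pd_cst.
  rewrite (pd_ext (g := fun=> 0) j oU Ux) => [|y _]; last exact: pd_cst.
  by rewrite !pd_cst.
- move=> k x Ux.
  rewrite (pd_ext (g := fun=> (j == k)%:R) i oU Ux) => [|y _]; last exact: pd_coord.
  rewrite (pd_ext (g := fun=> (i == k)%:R) j oU Ux) => [|y _]; last exact: pd_coord.
  by rewrite !pd_cst.
- move=> f g /te Tf Ef /te Tg Eg x Ux.
  have dD k y : U y -> pd k (fun y => f y + g y) y = pd k f y + pd k g y.
    exact: elem_pdD.
  have [pf pg] := (fun k => elem_pd k Tf, fun k => elem_pd k Tg).
  rewrite (pd_ext i oU Ux (dD j)) (pd_ext j oU Ux (dD i)).
  rewrite (elem_pdD i (pf j) (pg j) Ux) (elem_pdD j (pf i) (pg i) Ux).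
  by rewrite (Ef _ Ux) (Eg _ Ux).
- move=> f g /te Tf Ef /te Tg Eg x Ux.
  have dM k y : U y -> pd k (fun y => f y * g y) y = f y * pd k g y + g y * pd k f y.
    exact: elem_pdM.
  have [pf pg] := (fun k => elem_pd k Tf, fun k => elem_pd k Tg).
  rewrite (pd_ext i oU Ux (dM j)) (pd_ext j oU Ux (dM i)).
  rewrite (elem_pdD i (elemM Tf (pg j)) (elemM Tg (pf j)) Ux).
  rewrite (elem_pdD j (elemM Tf (pg i)) (elemM Tg (pf i)) Ux).
  rewrite (elem_pdM i Tf (pg j) Ux) (elem_pdM i Tg (pf j) Ux).
  rewrite (elem_pdM j Tf (pg i) Ux) (elem_pdM j Tg (pf i) Ux).
  rewrite (Ef _ Ux) (Eg _ Ux).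
  move: (pd i f x) (pd j f x) (pd i g x) (pd j g x) (f x) (g x) => a b c d e h.
  move: (pd j (pd i f) x) (pd j (pd i g) x) => a' b'; ring.
- move=> f /te Tf Ef f0 x Ux; have EV := elemV Tf f0.
  pose h y := (f y)^-1.
  (* Written as a product, so that the second derivative follows from the product rule and this same
     identity. *)
  have dV k y : U y -> pd k h y = h y * (h y * - pd k f y).
    by move=> Uy; rewrite /h elem_pdV ?f0// -exprVn; ring.
  have pf k := elemN (elem_pd k Tf).
  rewrite (pd_ext i oU Ux (dV j)) (pd_ext j oU Ux (dV i)).
  rewrite (elem_pdM i EV (elemM EV (pf j)) Ux) (elem_pdM j EV (elemM EV (pf i)) Ux).
  rewrite (elem_pdM i EV (pf j) Ux) (elem_pdM j EV (pf i) Ux).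
  rewrite (elem_pdN i (elem_pd j Tf) Ux) (elem_pdN j (elem_pd i Tf) Ux).
  rewrite (dV i _ Ux) (dV j _ Ux) (Ef _ Ux).
  move: (pd i f x) (pd j f x) (h x) (pd j (pd i f) x) => a b c d; ring.
- move=> f r /te Tf Ef f0 x Ux.
  have dP k y : U y -> pd k (fun y => f y `^ r) y = f y `^ (r - 1) * (r * pd k f y).
    by move=> Uy; rewrite elem_pd_powR//; ring.
  have pf k := elem_pd k Tf.
  have Er : elem U (fun y => f y `^ (r - 1)) by exact: elem_powR.
  have Em k : elem U (fun y => r * pd k f y) := elemM (elem_cst U r) (pf k).
  rewrite (pd_ext i oU Ux (dP j)) (pd_ext j oU Ux (dP i)).
  rewrite (elem_pdM i Er (Em j) Ux) (elem_pdM j Er (Em i) Ux).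
  rewrite (elem_pdM i (elem_cst U r) (pf j) Ux) (elem_pdM j (elem_cst U r) (pf i) Ux).
  rewrite !pd_cst (elem_pd_powR _ _ Tf f0 Ux) (elem_pd_powR _ _ Tf f0 Ux) (Ef _ Ux).
  move: (pd i f x) (pd j f x) (pd j (pd i f) x) => a b c; ring.
Qed.

End PdRules.

End Elementary.

Section MatrixElem.
Context {R : realType} {n : nat}.
Local Notation V := 'rV[R]_n.

Lemma elem_det (U : set V) m (M : V -> 'M[R]_m) :
  (forall i j, elem U (fun y => M y i j)) -> elem U (fun y => \det (M y)).
Proof.
move=> EM; rewrite /determinant; apply: elem_sum => s; apply: elemM.
  exact: elem_cst.
by apply: elem_prod => i.
Qed.

(** Cramer's rule: where the determinant does not vanish, the entries of the inverse are cofactors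
    over the determinant, and both are polynomials in the entries. *)
Lemma elem_invmx (U : set V) m (M : V -> 'M[R]_m) k l :
  (forall i j, elem U (fun y => M y i j)) ->
  (forall y, U y -> \det (M y) != 0) -> elem U (fun y => invmx (M y) k l).
Proof.
move=> EM d0.
have E : elem U (fun y => (\det (M y))^-1 * ((-1) ^+ (l + k) *
    \det (\matrix_(i, j) M y (lift l i) (lift k j)))).
  apply: elemM; first by apply: elemV => //; exact: elem_det.
  apply: elemM; first exact: elem_cst.
  by apply: elem_det => i j; apply: elem_ext (EM (lift l i) (lift k j)) _ => y _; rewrite mxE.
apply: elem_ext E _ => y Uy.
rewrite /invmx unitmxE unitfE d0// !mxE /cofactor; congr (_ * (_ * \det _)).
by apply/matrixP => i j; rewrite !mxE.
Qed.

End MatrixElem.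

Section Algebra.
Variables (R : comNzRingType) (n : nat).
Implicit Types (i j k l p q m : 'I_n).

(** With [gi] the inverse metric and [c], [C] the Christoffel symbols of the first and second kind,
    the first factor on the left is the derivative of the inverse metric along [m]. The first sum on
    the right will cancel the quadratic terms of [ricci]. *)
Lemma contract_dinv (gi : 'I_n -> 'I_n -> R) (c : 'I_n -> 'I_n -> 'I_n -> R)
    (C : 'I_n -> 'I_n -> 'I_n -> R) k m i j :
  (forall p q, gi p q = gi q p) ->
  (forall q i j, C q i j = \sum_l gi q l * c l i j) ->
  \sum_l (- \sum_p \sum_q gi k p * (c p m q + c q m p) * gi q l) * c l i j =
  - \sum_q C k m q * C q i j - \sum_p \sum_q gi k p * c q m p * C q i j.
Proof.
move=> giC CE.
transitivity (- \sum_p \sum_q gi k p * (c p m q + c q m p) * C q i j).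
  rewrite -sumrN; under eq_bigr => l _ do rewrite -sumrN mulr_suml.
  rewrite exchange_big; apply: eq_bigr => p _ /=.
  under eq_bigr => l _ do rewrite -sumrN mulr_suml.
  rewrite exchange_big -sumrN; apply: eq_bigr => q _ /=.
  rewrite CE mulr_sumr -sumrN; apply: eq_bigr => l _.
  by rewrite !mulNr !mulrA.
rewrite -opprD; congr (- _).
rewrite [X in _ = X + _](_ : _ = \sum_p \sum_q gi k p * c p m q * C q i j).
  rewrite -big_split; apply: eq_bigr => p _ /=; rewrite -big_split; apply: eq_bigr => q _ /=.
  by rewrite mulrDr mulrDl.
rewrite exchange_big; apply: eq_bigr => q _ /=.
by rewrite CE mulr_suml; apply: eq_bigr => p _.
Qed.

End Algebra.

(** * The Gauss equation *)

(* [pd] unfolds to a limit, which conversion must not enter. *)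
Local Opaque pd.

Section Gauss.
Context {R : realType} {n : nat}.
Local Notation V := 'rV[R]_n.
Variables (U : set V) (oU : open U) (A : finType) (c : A -> R) (F : A -> V -> R).
Hypothesis EF : forall a, elem U (F a).
Variable g : @metric_field R n.
Hypothesis gE : forall y, U y -> forall i j,
  g i j y = \sum_a c a * (pd i (F a) y * pd j (F a) y).
Hypothesis g0 : forall y, U y -> \det (gmx g y) != 0.
Implicit Types (i j k l p q m : 'I_n) (x y : V).

(* Christoffel symbols of the first kind of the metric induced by [F] from the flat form
   [\sum_a c a * (u a * w a)]. *)
Definition chr1 l i j y := \sum_a c a * (pd i (pd j (F a)) y * pd l (F a) y).
Definition hip i j k l y :=
  \sum_a c a * (pd i (pd j (F a)) y * pd k (pd l (F a)) y).

Lemma elem_pd1 i a : elem U (pd i (F a)). Proof. exact: elem_pd. Qed.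
Lemma elem_pd2 i j a : elem U (pd i (pd j (F a))). Proof. exact/elem_pd/elem_pd. Qed.

Lemma elem_metric i j : elem U (g i j).
Proof.
apply: (elem_ext (g := fun y => \sum_a c a * (pd i (F a) y * pd j (F a) y))).
  by apply: elem_sum => a; apply: elemM; [exact: elem_cst|apply: elemM; exact: elem_pd1].
by move=> y Uy; exact: gE.
Qed.

Lemma elem_chr1 l i j : elem U (chr1 l i j).
Proof.
apply: elem_sum => a; apply: elemM; first exact: elem_cst.
by apply: elemM; [exact: elem_pd2|exact: elem_pd1].
Qed.

Lemma elem_ginv k l : elem U (fun y => ginv g y k l).
Proof.
apply: elem_invmx => // i j.
by apply: elem_ext (elem_metric i j) _ => y _; rewrite mxE.
Qed.

Lemma chr1C l i j y : U y -> chr1 l i j y = chr1 l j i y.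
Proof. by move=> Uy; apply: eq_bigr => a _; rewrite (pdC oU i j (EF a) Uy). Qed.

Lemma pd_cM m (b : R) (u w : V -> R) y : U y -> elem U u -> elem U w ->
  pd m (fun y => b * (u y * w y)) y = b * (u y * pd m w y + w y * pd m u y).
Proof.
move=> Uy Eu Ew; rewrite (elem_pdM oU m (elem_cst U b) (elemM Eu Ew) Uy) pd_cst mulr0 addr0.
by rewrite (elem_pdM oU m Eu Ew Uy).
Qed.

Lemma pd_metric m p q y : U y -> pd m (g p q) y = chr1 p m q y + chr1 q m p y.
Proof.
move=> Uy; rewrite (pd_ext m oU Uy (fun y Uy => gE Uy p q)).
rewrite (elem_pd_sum oU)//; last first.
  by move=> a; apply: elemM; [exact: elem_cst|apply: elemM; exact: elem_pd1].
rewrite /chr1 -big_split; apply: eq_bigr => a _ /=.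
rewrite (pd_cM m (c a) Uy (elem_pd1 p a) (elem_pd1 q a)).
move: (pd p (F a) y) (pd q (F a) y) => u w.
move: (pd m (pd q (F a)) y) (pd m (pd p (F a)) y) => u' w'; ring.
Qed.

(** Each derivative of the metric is a sum of two symbols of the first kind; of the six, four cancel
    by symmetry and two agree. *)
Lemma christE k i j y : U y -> christ g k i j y = \sum_l ginv g y k l * chr1 l i j y.
Proof.
move=> Uy; rewrite /christ mulr_sumr; apply: eq_bigr => l _.
rewrite !(pd_metric _ _ _ Uy).
rewrite (chr1C l j i Uy) (chr1C i l j Uy) (chr1C j l i Uy).
move: (chr1 l i j y) (chr1 i j l y) (chr1 j i l y) (ginv g y k l) => a b d e.
by field.
Qed.

Lemma ginvC y k l : U y -> ginv g y k l = ginv g y l k.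
Proof.
move=> Uy; rewrite /ginv -[in RHS](trmxK (invmx (gmx g y))) trmx_inv mxE.
congr (invmx _ _ _); apply/matrixP => i j; rewrite !mxE !(gE Uy).
by apply: eq_bigr => a _; rewrite (mulrC (pd j (F a) y)).
Qed.

Lemma ginv_mul y k j : U y -> \sum_l ginv g y k l * g l j y = (k == j)%:R.
Proof.
move=> Uy; have := @mulVmx _ _ (gmx g y); rewrite unitmxE unitfE g0// => /(_ isT).
move/matrixP => /(_ k j); rewrite !mxE => <-.
by apply: eq_bigr => l _; rewrite !mxE.
Qed.

Lemma mul_ginv y k j : U y -> \sum_l g k l y * ginv g y l j = (k == j)%:R.
Proof.
move=> Uy; have := @mulmxV _ _ (gmx g y); rewrite unitmxE unitfE g0// => /(_ isT).
move/matrixP => /(_ k j); rewrite !mxE => <-.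
by apply: eq_bigr => l _; rewrite !mxE.
Qed.

(** Differentiate [g^-1 g = 1] and multiply by [g^-1] on the right. *)
Lemma pd_ginv m k l y : U y -> pd m (fun y => ginv g y k l) y =
  - \sum_p \sum_q ginv g y k p * (chr1 p m q y + chr1 q m p y) * ginv g y q l.
Proof.
move=> Uy.
have H j : \sum_q pd m (fun y => ginv g y k q) y * g q j y =
   - \sum_p ginv g y k p * (chr1 p m j y + chr1 j m p y).
  apply/eqP; rewrite -addr_eq0 -big_split /=; apply/eqP.
  transitivity (pd m (fun y => \sum_q ginv g y k q * g q j y) y).
    rewrite (elem_pd_sum oU)//; last by move=> q; exact: elemM (elem_ginv k q) (elem_metric q j).
    apply: eq_bigr => q _.
    rewrite (elem_pdM oU m (elem_ginv k q) (elem_metric q j) Uy) (pd_metric m q j Uy).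
    by rewrite addrC [X in _ + X = _]mulrC.
  rewrite (pd_ext (g := fun=> (k == j)%:R) m oU Uy) ?pd_cst// => z Uz.
  exact: ginv_mul.
transitivity (\sum_j (\sum_q pd m (fun y => ginv g y k q) y * g q j y) * ginv g y j l).
  under eq_bigr => j _ do rewrite mulr_suml.
  rewrite exchange_big /=.
  under eq_bigr => q _ do under eq_bigr => j _ do rewrite -mulrA.
  under eq_bigr => q _ do rewrite -mulr_sumr (mul_ginv q l Uy).
  rewrite (bigD1 l) //= eqxx mulr1 big1 ?addr0// => q /negbTE ->.
  by rewrite mulr0.
under eq_bigr => j _ do rewrite H mulNr mulr_suml.
by rewrite sumrN exchange_big.
Qed.

(** The terms with third derivatives of [F] agree by symmetry and drop out of the difference. *)
Lemma pd_chr1B k j i l y : U y ->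
  pd k (chr1 l i j) y - pd j (chr1 l i k) y = hip i j k l y - hip i k j l y.
Proof.
move=> Uy.
have H k' j' : pd k' (chr1 l i j') y =
    hip i j' k' l y + \sum_a c a * (pd l (F a) y * pd k' (pd i (pd j' (F a))) y).
  rewrite (elem_pd_sum oU)//; last first.
    by move=> a; apply: elemM; [exact: elem_cst|apply: elemM; [exact: elem_pd2|exact: elem_pd1]].
  rewrite /hip -big_split; apply: eq_bigr => a _ /=.
  by rewrite (pd_cM k' (c a) Uy (elem_pd2 i j' a) (elem_pd1 l a)) mulrDr.
rewrite !H opprD addrACA -[RHS]addr0; congr (_ + _); apply/eqP; rewrite subr_eq0.
apply/eqP/eq_bigr => a _; suff -> : pd k (pd i (pd j (F a))) y = pd j (pd i (pd k (F a))) y by [].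
rewrite (pdC oU k i (elem_pd1 j a) Uy) (pdC oU j i (elem_pd1 k a) Uy).
apply: (pd_ext i oU Uy) => z Uz; exact: (pdC oU k j (EF a) Uz).
Qed.

(** Differentiating the inverse metric in the Christoffel symbols produces terms that cancel the
    quadratic part of [ricci]. What remains are the ambient products [hip] minus their tangential
    parts, which are products of Christoffel symbols. *)
Lemma ricciE i j x : U x ->
  ricci g i j x = \sum_k \sum_l ginv g x k l * (hip i j k l x - hip i k j l x
     - \sum_q (chr1 q k l x * christ g q i j x - chr1 q j l x * christ g q i k x)).
Proof.
move=> Ux; pose gi k l := ginv g x k l.
have giC k l : gi k l = gi l k by exact: ginvC.
have CE q i' j' : christ g q i' j' x = \sum_l gi q l * chr1 l i' j' x by exact: christE.
have dC m k i' j' : pd m (christ g k i' j') x =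
    \sum_l gi k l * pd m (chr1 l i' j') x +
    (- \sum_q christ g k m q x * christ g q i' j' x
     - \sum_p \sum_q gi k p * chr1 q m p x * christ g q i' j' x).
  rewrite -(contract_dinv (c := fun l i j => chr1 l i j x) k m i' j' giC CE).
  rewrite (pd_ext (g := fun y => \sum_l ginv g y k l * chr1 l i' j' y) m oU Ux); last first.
    by move=> y Uy; exact: christE.
  rewrite (elem_pd_sum oU)//; last by move=> l; exact: elemM (elem_ginv k l) (elem_chr1 l i' j').
  rewrite -big_split; apply: eq_bigr => l _ /=.
  rewrite (elem_pdM oU m (elem_ginv k l) (elem_chr1 l i' j') Ux) (pd_ginv m k l Ux).
  by rewrite [X in _ + X = _]mulrC.
rewrite /ricci -big_split; apply: eq_bigr => k _ /=.
rewrite !dC.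
rewrite [\sum_(l < n) (_ - _)]big_split /= sumrN.
transitivity (\sum_l gi k l * (pd k (chr1 l i j) x - pd j (chr1 l i k) x)
  - \sum_p \sum_q gi k p * (chr1 q k p x * christ g q i j x - chr1 q j p x * christ g q i k x)).
  have -> : \sum_l gi k l * (pd k (chr1 l i j) x - pd j (chr1 l i k) x) =
     \sum_l gi k l * pd k (chr1 l i j) x - \sum_l gi k l * pd j (chr1 l i k) x.
    by rewrite -sumrB; apply: eq_bigr => l _; rewrite mulrBr.
  have -> : \sum_p \sum_q gi k p * (chr1 q k p x * christ g q i j x - chr1 q j p x * christ g q i k x)
     = \sum_p \sum_q gi k p * chr1 q k p x * christ g q i j x
       - \sum_p \sum_q gi k p * chr1 q j p x * christ g q i k x.
    rewrite -sumrB; apply: eq_bigr => p _; rewrite -sumrB; apply: eq_bigr => q _.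
    have alg (a b d e f : R) : a * (b * d - e * f) = a * b * d - a * e * f by ring.
    exact: alg.
  have alg (a1 a2 q1 q2 p1 p2 : R) :
    a1 + (- q1 - p1) - (a2 + (- q2 - p2)) + (q1 - q2) = a1 - a2 - (p1 - p2) by ring.
  exact: alg.
rewrite -sumrB; apply: eq_bigr => l _.
rewrite (pd_chr1B k j i l Ux) -/(gi k l) [RHS]mulrBr; congr (_ - _).
by rewrite mulr_sumr.
Qed.

End Gauss.

(** * Linear algebra of Minkowski space *)

Section Completeness.
Variables (R : comUnitRingType) (N : nat).

(** The hypothesis says M K M^T E = 1, with K the diagonal matrix of [c]. A right inverse of a
    square matrix is a left inverse, so K M^T E M = 1 can be inserted before K in u K w. *)
Lemma completeness (M E : 'M[R]_N) (c u w : 'I_N -> R) :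
  (forall r s, \sum_t (\sum_a c a * (M r a * M t a)) * E t s = (r == s)%:R) ->
  \sum_a c a * (u a * w a) =
  \sum_r \sum_s E r s * ((\sum_a c a * (u a * M r a)) * (\sum_a c a * (w a * M s a))).
Proof.
move=> H; pose K := diag_mx (\row_a c a).
have H1 : M *m (K *m M^T *m E) = 1%:M.
  apply/matrixP => r s; rewrite !mulmxA !mxE -H; apply: eq_bigr => t _.
  congr (_ * _); rewrite !mxE; apply: eq_bigr => a _.
  by rewrite mul_mx_diag !mxE; ring.
have H2 := mulmx1C H1.
pose ur : 'rV_N := \row_a u a; pose wc : 'cV_N := \col_a w a.
have -> : \sum_a c a * (u a * w a) = (ur *m K *m wc) 0 0.
  rewrite mxE; apply: eq_bigr => a _; rewrite mul_mx_diag !mxE; ring.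
have -> : ur *m K *m wc = ur *m K *m M^T *m E *m (M *m K *m wc).
  by rewrite -[K in LHS]mul1mx -H2 !mulmxA.
have uE r : (ur *m K *m M^T) 0 r = \sum_a c a * (u a * M r a).
  by rewrite mxE; apply: eq_bigr => a _; rewrite mul_mx_diag !mxE; ring.
have wE s : (M *m K *m wc) s 0 = \sum_a c a * (w a * M s a).
  by rewrite mxE; apply: eq_bigr => a _; rewrite mul_mx_diag !mxE; ring.
rewrite mxE exchange_big; apply: eq_bigr => s _ /=.
rewrite [X in X * _]mxE wE mulr_suml; apply: eq_bigr => r _.
by rewrite uE; ring.
Qed.

End Completeness.

Section NullVectors.
Variables (R : realType) (n : nat).
Implicit Types u w : 'I_n -> R.

(* Minkowski space R^(n+1,1) with the last two coordinates (p + q)/2 and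
   (p - q)/2, so that the quadratic form is |u|^2 + p q. *)
Definition mvec u (q p : R) (a : 'I_(n + 2)) : R :=
  match fintype.split a with
  | inl k => u k
  | inr k => if k == 0 then (p + q) / 2 else (p - q) / 2
  end.

Definition msign (a : 'I_(n + 2)) : R :=
  match fintype.split a with inl _ => 1 | inr k => if k == 0 then 1 else -1 end.

Lemma sum_split2 (S : nmodType) (f : 'I_(n + 2) -> S) :
  \sum_a f a = \sum_k f (lshift 2 k) + (f (rshift n ord0) + f (rshift n (lift ord0 ord0))).
Proof. by rewrite big_split_ord big_ord_recl big_ord1. Qed.

Lemma split_l (k : 'I_n) : fintype.split (lshift 2 k) = inl k.
Proof. exact: (unsplitK (inl k)). Qed.

Lemma split_r (k : 'I_2) : fintype.split (rshift n k) = inr k.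
Proof. exact: (unsplitK (inr k)). Qed.

Definition mip (u w : 'I_(n + 2) -> R) : R := \sum_a msign a * (u a * w a).

Lemma mvec_dot u q p w q' p' :
  mip (mvec u q p) (mvec w q' p') =
  \sum_k u k * w k + (p * q' + q * p') / 2.
Proof.
rewrite /mip sum_split2 /msign /mvec !split_r /=.
congr (_ + _); last by field.
by apply: eq_bigr => k _; rewrite !split_l mul1r.
Qed.

Lemma sum_split22 (S : nmodType) (f : 'I_(n + 2) -> 'I_(n + 2) -> S) :
  (forall k, f (lshift 2 k) (rshift n ord0) = 0) ->
  (forall k, f (lshift 2 k) (rshift n (lift ord0 ord0)) = 0) ->
  (forall k, f (rshift n ord0) (lshift 2 k) = 0) ->
  (forall k, f (rshift n (lift ord0 ord0)) (lshift 2 k) = 0) ->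
  f (rshift n ord0) (rshift n (lift ord0 ord0)) = 0 ->
  f (rshift n (lift ord0 ord0)) (rshift n ord0) = 0 ->
  \sum_r \sum_s f r s = \sum_k \sum_l f (lshift 2 k) (lshift 2 l) +
   (f (rshift n ord0) (rshift n ord0) +
    f (rshift n (lift ord0 ord0)) (rshift n (lift ord0 ord0))).
Proof.
move=> h1 h2 h3 h4 h5 h6.
rewrite sum_split2 !(sum_split2 (f (rshift _ _))) h5 h6 addr0 add0r.
have -> : \sum_k f (rshift n ord0) (lshift 2 k) = 0 by exact: big1.
have -> : \sum_k f (rshift n (lift ord0 ord0)) (lshift 2 k) = 0 by exact: big1.
rewrite !add0r.
by congr (_ + _); apply: eq_bigr => k _; rewrite sum_split2 h1 h2 !addr0.
Qed.

(* For a basis of tangent vectors T k with Gram matrix g, a unit spacelike normal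
   P and a unit timelike normal m. *)
Lemma normal_decomposition (T : 'I_n -> 'I_(n + 2) -> R) (P m u w : 'I_(n + 2) -> R)
    (g gi : 'I_n -> 'I_n -> R) :
  (forall k l, mip (T k) (T l) = g k l) ->
  (forall k l, \sum_j g k j * gi j l = (k == l)%:R) ->
  (forall k, mip (T k) P = 0) -> (forall k, mip (T k) m = 0) ->
  mip P P = 1 -> mip m m = -1 -> mip P m = 0 ->
  mip u w = \sum_k \sum_l gi k l * (mip u (T k) * mip w (T l)) + mip u P * mip w P - mip u m * mip w m.
Proof.
move=> gT gK TP Tm PP mm Pm; set ip := mip in gT TP Tm PP mm Pm *.
have ipC (u' w' : 'I_(n + 2) -> R) : ip u' w' = ip w' u'.
  by apply: eq_bigr => a _; rewrite (mulrC (u' a)).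
(* The rows of [M] are the basis vectors; [E] is the inverse of their Gram matrix, block diagonal by
   orthogonality. *)
pose M : 'M[R]_(n + 2) := \matrix_(r, a) match fintype.split r with
  | inl k => T k a | inr k => if k == 0 then P a else m a end.
pose E : 'M[R]_(n + 2) := \matrix_(r, s) match fintype.split r, fintype.split s with
  | inl k, inl l => gi k l
  | inr k, inr l => if k != l then 0 else if k == 0 then 1 else -1
  | _, _ => 0 end.
have Ml k a : M (lshift 2 k) a = T k a by rewrite mxE split_l.
have M0 a : M (rshift n ord0) a = P a by rewrite mxE split_r.
have M1 a : M (rshift n (lift ord0 ord0)) a = m a by rewrite mxE split_r.
have ipl (u' : 'I_(n + 2) -> R) k : \sum_a msign a * (u' a * M (lshift 2 k) a) = ip u' (T k).
  by apply: eq_bigr => a _; rewrite Ml.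
have ip0 (u' : 'I_(n + 2) -> R) : \sum_a msign a * (u' a * M (rshift n ord0) a) = ip u' P.
  by apply: eq_bigr => a _; rewrite M0.
have ip1 (u' : 'I_(n + 2) -> R) : \sum_a msign a * (u' a * M (rshift n (lift ord0 ord0)) a) = ip u' m.
  by apply: eq_bigr => a _; rewrite M1.
rewrite -/ip [LHS](completeness (M := M) (E := E) u w) => [|r s].
  rewrite sum_split22 => [|k|k|k|k||]; try by rewrite !mxE !(split_l, split_r) mul0r.
  rewrite !(ipl, ip0, ip1) -addrA; congr (_ + _).
    apply: eq_bigr => k _; apply: eq_bigr => l _.
    by rewrite !ipl !mxE !split_l.
  by rewrite !mxE !split_r/= mul1r mulN1r.
have Ell k l : E (lshift 2 k) (lshift 2 l) = gi k l by rewrite mxE !split_l.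
have Elr k l : E (lshift 2 k) (rshift n l) = 0 by rewrite mxE split_l split_r.
have Erl k l : E (rshift n k) (lshift 2 l) = 0 by rewrite mxE split_l split_r.
have Err k l : E (rshift n k) (rshift n l) = if k != l then 0 else if k == 0 then 1 else -1.
  by rewrite mxE !split_r.
have MlE k : M (lshift 2 k) = T k by apply/funext => a; exact: Ml.
have M0E : M (rshift n ord0) = P by apply/funext => a; exact: M0.
have M1E : M (rshift n (lift ord0 ord0)) = m by apply/funext => a; exact: M1.
have ord2 (k : 'I_2) : k = ord0 \/ k = lift ord0 ord0.
  by case: k => [[|[|]]//= ?]; [left|right]; exact: val_inj.
have rr (k l : 'I_2) : (rshift n k == rshift n l) = (k == l) by rewrite (inj_eq (@rshift_inj _ _)).
have ll (k l : 'I_n) : (lshift 2 k == lshift 2 l) = (k == l) by rewrite (inj_eq (@lshift_inj _ _)).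
rewrite sum_split2 (ip0 (M r)) (ip1 (M r)).
under eq_bigr => t _ do rewrite (ipl (M r)).
case: (fintype.split_ordP r) => k ->; last case: (ord2 k) => ->.
- rewrite MlE TP Tm !mul0r !addr0.
  under eq_bigr => t _ do rewrite gT.
  case: (fintype.split_ordP s) => l ->.
    by under eq_bigr => t _ do rewrite Ell; rewrite gK ll.
  rewrite big1 => [|t _]; last by rewrite Elr mulr0.
  by rewrite eq_lrshift.
- rewrite M0E PP Pm mul0r addr0 mul1r big1 => [|t _]; last by rewrite ipC TP mul0r.
  rewrite add0r; case: (fintype.split_ordP s) => l ->; first by rewrite Erl eq_rlshift.
  by rewrite Err rr; case: (ord2 l) => ->.
- rewrite M1E mm (ipC m P) Pm mul0r add0r mulN1r big1 => [|t _]; last by rewrite ipC Tm mul0r.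
  rewrite add0r; case: (fintype.split_ordP s) => l ->; first by rewrite Erl eq_rlshift oppr0.
  by rewrite Err rr; case: (ord2 l) => -> /=; rewrite ?oppr0 ?opprK.
Qed.

End NullVectors.

(** * Spacelike hypersurfaces of de Sitter space *)

Section Hypersurface.
Context {R : realType} {n : nat}.
Local Notation V := 'rV[R]_n.
Variables (U : set V) (oU : open U) (F m : 'I_(n + 2) -> V -> R).
Hypothesis EF : forall a, elem U (F a).
Hypothesis Em : forall a, elem U (m a).
Variable g : @metric_field R n.
Implicit Types (i j k l p q : 'I_n) (x y : V).

Definition ip (u w : 'I_(n + 2) -> V -> R) y := mip (u^~ y) (w^~ y).
Local Notation dF i := (fun a => pd i (F a)).

Hypothesis gE : forall y, U y -> forall i j, g i j y = ip (dF i) (dF j) y.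
Hypothesis g0 : forall y, U y -> \det (gmx g y) != 0.
Hypothesis FF : forall y, U y -> ip F F y = 1.
Hypothesis mm : forall y, U y -> ip m m y = -1.
Hypothesis Fm : forall y, U y -> ip F m y = 0.
Hypothesis dFm : forall i y, U y -> ip (dF i) m y = 0.

(** Second fundamental form for the timelike normal [m]. In Minkowski space [F] is a second normal:
    it is the unit normal of de Sitter space, the quadric on which [mip] of a vector with itself is
    1. *)
Definition sff i j y := ip (dF j) (fun a => pd i (m a)) y.

Lemma pd_ip (u w : 'I_(n + 2) -> V -> R) i y :
  (forall a, elem U (u a)) -> (forall a, elem U (w a)) -> U y ->
  pd i (ip u w) y = ip (fun a => pd i (u a)) w y + ip u (fun a => pd i (w a)) y.
Proof.
move=> Eu Ew Uy; rewrite (elem_pd_sum oU)//; last first.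
  by move=> a; apply: elemM; [exact: elem_cst|exact: elemM].
rewrite -big_split; apply: eq_bigr => a _ /=.
rewrite (pd_cM oU i (msign R a) Uy (Eu a) (Ew a)).
move: (pd i (u a) y) (pd i (w a) y) => u' w'; ring.
Qed.

Lemma ipC u w y : ip u w y = ip w u y.
Proof. by apply: eq_bigr => a _; rewrite (mulrC (u a y)). Qed.

Lemma pd_cst_on (f : V -> R) (b : R) i y : (forall y, U y -> f y = b) -> U y -> pd i f y = 0.
Proof. by move=> fb Uy; rewrite (pd_ext (g := fun=> b) i oU Uy fb) pd_cst. Qed.

Let EdF i a : elem U (pd i (F a)). Proof. exact: elem_pd. Qed.

Lemma ip_dFF i y : U y -> ip (dF i) F y = 0.
Proof.
move=> Uy; have := pd_cst_on i FF Uy.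
rewrite (pd_ip i EF EF Uy) (ipC F) => /eqP.
by rewrite -mulr2n mulrn_eq0 /= => /eqP.
Qed.

Lemma ip_ddFF i j y : U y -> ip (fun a => pd i (pd j (F a))) F y = - g i j y.
Proof.
move=> Uy; have := pd_cst_on i (ip_dFF j) Uy.
rewrite (pd_ip i (EdF j) EF Uy) => /eqP; rewrite addr_eq0 => /eqP ->.
by rewrite ipC (gE Uy).
Qed.

Lemma ip_ddFm i j y : U y -> ip (fun a => pd i (pd j (F a))) m y = - sff i j y.
Proof.
move=> Uy; have := pd_cst_on i (dFm j) Uy.
by rewrite (pd_ip i (EdF j) Em Uy) => /eqP; rewrite addr_eq0 => /eqP ->.
Qed.

Lemma sffC i j y : U y -> sff i j y = sff j i y.
Proof.
move=> Uy; apply: oppr_inj; rewrite -(ip_ddFm i j Uy) -(ip_ddFm j i Uy); apply: eq_bigr => a _.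
by rewrite (pdC oU i j (EF a) Uy).
Qed.

Let gE' : forall y, U y -> forall i j,
  g i j y = \sum_a msign R a * (pd i (F a) y * pd j (F a) y) := gE.

(** The ambient product [hip] is split by [normal_decomposition]. The part along [F] gives the
    curvature 1 of de Sitter space; the part along [m] has a negative sign because [m] is
    timelike. *)
Lemma gauss_equation i j k l y : U y ->
  hip (@msign R n) F i j k l y =
  \sum_p \sum_q ginv g y p q * (chr1 (@msign R n) F p i j y * chr1 (@msign R n) F q k l y)
  + g i j y * g k l y - sff i j y * sff k l y.
Proof.
move=> Uy.
have e1 := ip_ddFF i j Uy; have e2 := ip_ddFF k l Uy.
have e3 := ip_ddFm i j Uy; have e4 := ip_ddFm k l Uy.
have alg (S a1 a2 b1 b2 g1 g2 h1 h2 : R) :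
    a1 = - g1 -> a2 = - g2 -> b1 = - h1 -> b2 = - h2 ->
    S + a1 * a2 - b1 * b2 = S + g1 * g2 - h1 * h2.
  by move=> -> -> -> ->; ring.
apply: etrans (normal_decomposition (T := fun k a => pd k (F a) y) (P := fun a => F a y)
  (m := fun a => m a y) (fun a => pd i (pd j (F a)) y) (fun a => pd k (pd l (F a)) y)
  (g := fun i j => g i j y) (gi := ginv g y) _ _ _ _ _ _ _) _.
- by move=> p q; rewrite (gE Uy).
- by move=> p q; exact: (mul_ginv g0).
- by move=> p; exact: ip_dFF.
- by move=> p; exact: dFm.
- exact: FF.
- exact: mm.
- exact: Fm.
exact: (alg _ _ _ _ _ _ _ _ _ e1 e2 e3 e4).
Qed.

(** The tangential part of [hip] is exactly what [ricciE] subtracts. *)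
Lemma ricci_hypersurface i j x : U x ->
  ricci g i j x = \sum_k \sum_l ginv g x k l *
    (g i j x * g k l x - sff i j x * sff k l x - (g i k x * g j l x - sff i k x * sff j l x)).
Proof.
move=> Ux; rewrite (ricciE oU EF gE' g0 i j Ux).
apply: eq_bigr => k _; apply: eq_bigr => l _; congr (_ * _).
rewrite (gauss_equation i j k l Ux) (gauss_equation i k j l Ux) sumrB.
have CE i' j' k' l' : \sum_q chr1 (@msign R n) F q k' l' x * christ g q i' j' x =
  \sum_p \sum_q ginv g x p q * (chr1 (@msign R n) F p i' j' x * chr1 (@msign R n) F q k' l' x).
  rewrite exchange_big; apply: eq_bigr => q _ /=.
  rewrite (christE oU EF gE' q i' j' Ux) mulr_sumr; apply: eq_bigr => p _.
  rewrite (ginvC gE' p q Ux).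
  move: (ginv g x q p) (chr1 _ _ _ _ _ _) (chr1 _ _ _ _ _ _) => a b d; ring.
rewrite !CE.
have alg (a b c d e f : R) : a + b - c - (d + e - f) - (a - d) = b - c - (e - f) by ring.
exact: alg.
Qed.

Lemma scal_hypersurface x : U x ->
  let W := invmx (gmx g x) *m \matrix_(i, j) sff i j x in
  scal g x = n%:R * (n%:R - 1) - (\tr W) ^+ 2 + \tr (W *m W).
Proof.
move=> Ux W.
have giC k l : ginv g x k l = ginv g x l k by exact: (ginvC gE').
have gC i j : g i j x = g j i x.
  by rewrite !(gE Ux) ipC.
have WE i j : W i j = \sum_l ginv g x i l * sff l j x.
  by rewrite mxE; apply: eq_bigr => l _; rewrite mxE.
have gi1 k j : \sum_l ginv g x k l * g l j x = (k == j)%:R by exact: (ginv_mul g0).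
(* Contractions common to the metric and to [sff]: the square of a trace here, the trace of a square
   in [T2]. *)
have T1 (h : 'I_n -> 'I_n -> R) :
  \sum_i \sum_j ginv g x i j * (\sum_k \sum_l ginv g x k l * (h i j * h k l)) =
  (\sum_i \sum_j ginv g x i j * h i j) ^+ 2.
  rewrite expr2 [RHS]mulr_suml; apply: eq_bigr => i _; rewrite mulr_suml.
  apply: eq_bigr => j _; rewrite -mulrA; congr (_ * _).
  rewrite mulr_sumr; apply: eq_bigr => k _; rewrite mulr_sumr; apply: eq_bigr => l _.
  ring.
have T2 (h : 'I_n -> 'I_n -> R) :
  \sum_i \sum_j ginv g x i j * (\sum_k \sum_l ginv g x k l * (h i k * h j l)) =
  \sum_j \sum_k (\sum_i ginv g x j i * h i k) * (\sum_l ginv g x k l * h j l).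
  rewrite exchange_big; apply: eq_bigr => j _ /=.
  transitivity (\sum_k \sum_i ginv g x j i * h i k * (\sum_l ginv g x k l * h j l)).
    rewrite exchange_big; apply: eq_bigr => i _ /=; rewrite mulr_sumr.
    apply: eq_bigr => k _; rewrite (giC i j) -mulrA; congr (_ * _).
    rewrite mulr_sumr; apply: eq_bigr => l _; ring.
  by apply: eq_bigr => k _; rewrite mulr_suml.
have -> : scal g x = (\sum_i \sum_j ginv g x i j * g i j x) ^+ 2
    - (\sum_i \sum_j ginv g x i j * sff i j x) ^+ 2
    - (\sum_j \sum_k (\sum_i ginv g x j i * g i k x) * (\sum_l ginv g x k l * g j l x)
    - \sum_j \sum_k (\sum_i ginv g x j i * sff i k x) * (\sum_l ginv g x k l * sff j l x)).
  rewrite -!T1 -!T2 -!sumrB; apply: eq_bigr => i _; rewrite -!sumrB; apply: eq_bigr => j _.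
  rewrite (ricci_hypersurface i j Ux) -!mulrBr; congr (_ * _).
  rewrite -!sumrB; apply: eq_bigr => k _; rewrite -!sumrB; apply: eq_bigr => l _.
  have alg (e a b d f : R) : e * (a - b - (d - f)) = e * a - e * b - (e * d - e * f) by ring.
  exact: alg.
have -> : \sum_i \sum_j ginv g x i j * g i j x = n%:R.
  rewrite -[RHS](@mxtrace1 R n); apply: eq_bigr => i _.
  under eq_bigr => j _ do rewrite gC.
  by rewrite gi1 mxE.
have -> : \sum_i \sum_j ginv g x i j * sff i j x = \tr W.
  apply: eq_bigr => i _; rewrite WE; apply: eq_bigr => j _.
  by rewrite (sffC i j Ux).
have -> : \sum_j \sum_k (\sum_i ginv g x j i * g i k x) * (\sum_l ginv g x k l * g j l x) = n%:R.
  rewrite -[RHS](@mxtrace1 R n); apply: eq_bigr => j _.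
  under eq_bigr => k _ do (rewrite gi1; under eq_bigr => l _ do rewrite gC; rewrite gi1).
  rewrite (bigD1 j)//= eqxx mul1r big1 ?addr0 ?mxE ?eqxx// => k kj.
  by rewrite eq_sym (negbTE kj) mul0r.
have -> : \sum_j \sum_k (\sum_i ginv g x j i * sff i k x) * (\sum_l ginv g x k l * sff j l x)
  = \tr (W *m W).
  apply: eq_bigr => j _; rewrite mxE; apply: eq_bigr => k _; rewrite !WE; congr (_ * _).
  by apply: eq_bigr => l _; rewrite (sffC j l Ux).
move: (\tr W) (\tr (W *m W)) => a b; ring.
Qed.

End Hypersurface.

(** * A family of hypersurfaces of de Sitter space *)

Section Embedding.
Context {R : realType} {n : nat}.
Local Notation V := 'rV[R]_n.
Variables (X G : 'I_n -> V -> R) (z gz : V -> R) (eps : R).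
Implicit Types (i j k : 'I_n) (x y : V).

(* [X] and [z] parametrize the round sphere; [G] and [gz] are the components of the
   gradient of the degree-one homogeneous extension of tau, so that tau = X . G + z gz. *)
Definition kap y := (1 + eps * gz y)^-1.
Definition shr y := eps * (kap y * z y).
Definition frx i a y := pd i (X a) y - shr y * pd i (G a) y.
Definition frz i y := pd i z y - shr y * pd i gz y.
Definition defm : @metric_field R n :=
  fun i j y => \sum_a frx i a y * frx j a y + frz i y * frz j y.

Let q y := kap y * z y.
Let N2 y := \sum_a G a y * G a y.
Let tau y := \sum_a X a y * G a y + z y * gz y.
Let p y := z y + (2 * eps * tau y - (eps * (z y * gz y) + eps * (shr y * N2 y))).
Let Y a y := X a y - shr y * G a y.
Let mx a y := eps * (kap y * G a y).
Let mq y := - kap y.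
Let mp y := 1 + eps * gz y + eps ^+ 2 * (kap y * N2 y).

(* The null coordinates are those of [mvec]: for [eps = 0] this is the totally geodesic
   sphere, as then [q y = p y = z y]. *)
Definition emb (a : 'I_(n + 2)) y := mvec (Y^~ y) (q y) (p y) a.
(** The point of hyperbolic space with upper half-space coordinates eps G and 1 + eps gz; [kap] is
    the inverse height. Now (G, gz) is the point with normal (X, z) on the Euclidean hypersurface
    with support function tau. Scaled by eps and moved to height about 1, this hypersurface has
    [emb] as unit normal for the conformal metric of the half-space: a hypersurface of hyperbolic
    space and its Gauss image in de Sitter space exchange position and normal. *)
Definition nrm (a : 'I_(n + 2)) y := mvec (mx^~ y) (mq y) (mp y) a.

Variables (U : set V) (oU : open U).
Hypothesis EX : forall a, elem U (X a).
Hypothesis EG : forall a, elem U (G a).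
Hypothesis Ez : elem U z.
Hypothesis Eg : elem U gz.
Hypothesis XX : forall y, U y -> \sum_a X a y * X a y = 1 - z y * z y.
Hypothesis XdG : forall i y, U y -> \sum_a X a y * pd i (G a) y = - (z y * pd i gz y).
Hypothesis k0 : forall y, U y -> 1 + eps * gz y != 0.

Let Ec c : elem U (fun=> c) := elem_cst U c.

Lemma elem_kap : elem U kap.
Proof. by apply: elemV => //; apply: elemD => //; apply: elemM. Qed.

Lemma elem_shr : elem U shr.
Proof. by apply: elemM => //; apply: elemM => //; exact: elem_kap. Qed.

Let Eq : elem U q. Proof. by apply: elemM => //; exact: elem_kap. Qed.
Let EN2 : elem U N2. Proof. by apply: elem_sum => a; exact: elemM. Qed.
Let Etau : elem U tau.
Proof. by apply: elemD; [apply: elem_sum => a|]; exact: elemM. Qed.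
Let EY a : elem U (Y a). Proof. by apply: elemB => //; apply: elemM => //; exact: elem_shr. Qed.
Let Emx a : elem U (mx a). Proof. by apply: elemM => //; apply: elemM => //; exact: elem_kap. Qed.
Let Emq : elem U mq. Proof. exact/elemN/elem_kap. Qed.
Let Ezg : elem U (fun y => eps * (z y * gz y)). Proof. by apply: elemM => //; exact: elemM. Qed.
Let EsN : elem U (fun y => eps * (shr y * N2 y)).
Proof. by apply: elemM => //; apply: elemM => //; exact: elem_shr. Qed.
Let Ekg : elem U (fun y => 1 + eps * gz y). Proof. by apply: elemD => //; exact: elemM. Qed.
Let EkN : elem U (fun y => eps ^+ 2 * (kap y * N2 y)).
Proof. by apply: elemM => //; apply: elemM => //; exact: elem_kap. Qed.
Let Emp : elem U mp. Proof. exact: elemD. Qed.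
Let Ep : elem U p.
Proof. by apply: elemD => //; apply: elemB; [exact: elemM|exact: elemD]. Qed.

Lemma elem_mvec (u : 'I_n -> V -> R) (r s : V -> R) a :
  (forall k, elem U (u k)) -> elem U r -> elem U s ->
  elem U (fun y => mvec (u^~ y) (r y) (s y) a).
Proof.
move=> Eu Er Es; rewrite /mvec; case: fintype.split => [k|k]; first exact: Eu.
by case: (k == 0); apply: elemM => //; [exact: elemD|exact: elemB].
Qed.

Lemma pd_mvec (u : 'I_n -> V -> R) (r s : V -> R) a i y :
  (forall k, elem U (u k)) -> elem U r -> elem U s -> U y ->
  pd i (fun y => mvec (u^~ y) (r y) (s y) a) y =
  mvec (fun k => pd i (u k) y) (pd i r y) (pd i s y) a.
Proof.
move=> Eu Er Es Uy; rewrite /mvec; case: fintype.split => [k|k] //.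
case: (k == 0).
  rewrite (elem_pdM oU i (elemD Es Er) (Ec _) Uy) pd_cst mulr0 add0r.
  by rewrite (elem_pdD oU i Es Er Uy) mulrC.
rewrite (elem_pdM oU i (elemB Es Er) (Ec _) Uy) pd_cst mulr0 add0r.
by rewrite (elem_pdB oU i Es Er Uy) mulrC.
Qed.

Lemma elem_emb a : elem U (emb a). Proof. exact: elem_mvec. Qed.
Lemma elem_nrm a : elem U (nrm a). Proof. exact: elem_mvec. Qed.

Lemma pd_Zl (c : R) f i y : elem U f -> U y -> pd i (fun y => c * f y) y = c * pd i f y.
Proof. by move=> Ef Uy; rewrite (elem_pdM oU i (Ec c) Ef Uy) pd_cst mulr0 addr0. Qed.

Lemma pd_kap i y : U y -> pd i kap y = - (eps * (kap y) ^+ 2 * pd i gz y).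
Proof.
move=> Uy; rewrite (elem_pdV oU i Ekg (k0 Uy) Uy).
rewrite (elem_pdD oU i (Ec 1) (elemM (Ec eps) Eg) Uy) pd_cst add0r (pd_Zl eps i Eg Uy).
rewrite -exprVn -/(kap y); move: (kap y) (pd i gz y) => a b; ring.
Qed.

Lemma pd_q i y : U y -> pd i q y = kap y * frz i y.
Proof.
move=> Uy; rewrite (elem_pdM oU i elem_kap Ez Uy) (pd_kap i Uy) /frz /shr.
move: (kap y) (pd i z y) (pd i gz y) (z y) => a b c d; ring.
Qed.

Lemma pd_shr i y : U y -> pd i shr y = eps * (kap y * frz i y).
Proof. by move=> Uy; rewrite (pd_Zl eps i Eq Uy) (pd_q i Uy). Qed.

Lemma pd_Y i a y : U y -> pd i (Y a) y = frx i a y - eps * kap y * frz i y * G a y.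
Proof.
move=> Uy; rewrite (elem_pdB oU i (EX a) (elemM elem_shr (EG a)) Uy).
rewrite (elem_pdM oU i elem_shr (EG a) Uy) (pd_shr i Uy) /frx.
move: (pd i (X a) y) (pd i (G a) y) (frz i y) => b c d; ring.
Qed.

Lemma pd_N2 i y : U y -> pd i N2 y = 2 * \sum_a G a y * pd i (G a) y.
Proof.
move=> Uy; rewrite (elem_pd_sum oU)//; last by move=> a; exact: elemM.
rewrite mulr_sumr; apply: eq_bigr => a _; rewrite (elem_pdM oU i (EG a) (EG a) Uy).
move: (G a y) (pd i (G a) y) => b c; ring.
Qed.

Lemma pd_tau i y : U y -> pd i tau y = \sum_a G a y * pd i (X a) y + gz y * pd i z y.
Proof.
move=> Uy; rewrite (elem_pdD oU i (elem_sum _ _ (fun a => elemM (EX a) (EG a))) (elemM Ez Eg) Uy).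
rewrite (elem_pd_sum oU)//; last by move=> a; exact: elemM.
rewrite (elem_pdM oU i Ez Eg Uy).
under eq_bigr => a _ do rewrite (elem_pdM oU i (EX a) (EG a) Uy).
rewrite big_split /= (XdG i Uy).
move: (\sum_a _) (z y) (gz y) (pd i z y) (pd i gz y) => a b c d e; ring.
Qed.

Lemma sum_frxG i y : \sum_a frx i a y * G a y =
  \sum_a G a y * pd i (X a) y - shr y * \sum_a G a y * pd i (G a) y.
Proof.
rewrite mulr_sumr -sumrB; apply: eq_bigr => a _; rewrite /frx.
move: (G a y) (pd i (X a) y) (pd i (G a) y) => b c d; ring.
Qed.

Lemma pd_p i y : U y -> pd i p y = (1 + eps * gz y) * frz i y
  + 2 * eps * (\sum_a frx i a y * G a y) - eps ^+ 2 * kap y * N2 y * frz i y.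
Proof.
move=> Uy.
rewrite (elem_pdD oU i Ez (elemB (elemM (Ec (2 * eps)) Etau) (elemD Ezg EsN)) Uy).
rewrite (elem_pdB oU i (elemM (Ec (2 * eps)) Etau) (elemD Ezg EsN) Uy).
rewrite (pd_Zl _ i Etau Uy) (elem_pdD oU i Ezg EsN Uy).
rewrite (pd_Zl _ i (elemM Ez Eg) Uy) (pd_Zl _ i (elemM elem_shr EN2) Uy).
rewrite (elem_pdM oU i Ez Eg Uy) (elem_pdM oU i elem_shr EN2 Uy) (pd_shr i Uy).
rewrite (pd_N2 i Uy) (pd_tau i Uy) sum_frxG.
have := k0 Uy; rewrite /frz /shr /kap.
move: (\sum_a G a y * pd i (X a) y) (\sum_a G a y * pd i (G a) y) => s1 s2.
move: (N2 y) (gz y) (z y) (pd i z y) (pd i gz y) => a b c d e h0.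
by field.
Qed.

Lemma sum_lin2 (u v w t : 'I_n -> R) (a b : R) :
  \sum_k (u k - a * v k) * (w k - b * t k) =
  \sum_k u k * w k - b * \sum_k u k * t k - a * \sum_k v k * w k + a * b * \sum_k v k * t k.
Proof.
rewrite !mulr_sumr -!sumrB -big_split; apply: eq_bigr => k _ /=; ring.
Qed.

Lemma pd_emb i a y : U y -> pd i (emb a) y =
  mvec (fun k => pd i (Y k) y) (pd i q y) (pd i p y) a.
Proof. by move=> Uy; exact: pd_mvec. Qed.

Lemma pd_nrm i a y : U y -> pd i (nrm a) y =
  mvec (fun k => pd i (mx k) y) (pd i mq y) (pd i mp y) a.
Proof. by move=> Uy; exact: pd_mvec. Qed.

Lemma eq_mip (u v w t : 'I_(n + 2) -> R) : u =1 w -> v =1 t -> mip u v = mip w t.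
Proof. by move=> uw vt; apply: eq_bigr => a _; rewrite uw vt. Qed.

(** By [pd_Y], [pd_q] and [pd_p], the derivative of [emb] depends on (frx, frz) as [emb] does on (X,
    z), through a linear isometry of Euclidean space into Minkowski space. So the Gram matrix is the
    Euclidean one. *)
Lemma emb_metric i j y : U y ->
  defm i j y = ip (fun a => pd i (emb a)) (fun a => pd j (emb a)) y.
Proof.
move=> Uy; rewrite /ip (eq_mip (fun a => pd_emb i a Uy) (fun a => pd_emb j a Uy)) mvec_dot.
rewrite !(pd_q _ Uy) !(pd_p _ Uy).
under eq_bigr => k _ do rewrite (pd_Y i k Uy) (pd_Y j k Uy).
rewrite (sum_lin2 (frx i ^~ y) (G^~ y) (frx j ^~ y) (G^~ y)).
under [\sum_k G k y * frx j k y]eq_bigr => k _ do rewrite mulrC.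
rewrite -/(N2 y) /defm.
have := k0 Uy; rewrite /kap.
move: (\sum_a frx i a y * frx j a y) (\sum_a frx i a y * G a y) (\sum_a frx j a y * G a y).
move: (N2 y) (gz y) (frz i y) (frz j y) => a b c d e h m h0.
by field.
Qed.

Lemma emb_unit y : U y -> ip emb emb y = 1.
Proof.
move=> Uy; rewrite /ip /emb mvec_dot (sum_lin2 (X^~ y) (G^~ y) (X^~ y) (G^~ y)).
under [\sum_k G k y * X k y]eq_bigr => k _ do rewrite mulrC.
rewrite (XX Uy) /q /p /tau -/(N2 y).
have := k0 Uy; rewrite /shr /kap.
move: (\sum_a X a y * G a y) (N2 y) (gz y) (z y) => a b c d h0.
by field.
Qed.

Lemma nrm_unit y : U y -> ip nrm nrm y = -1.
Proof.
move=> Uy; rewrite /ip /nrm mvec_dot /mx /mq /mp.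
have -> : \sum_k eps * (kap y * G k y) * (eps * (kap y * G k y)) = (eps * kap y) ^+ 2 * N2 y.
  rewrite mulr_sumr; apply: eq_bigr => k _; ring.
have := k0 Uy; rewrite /kap.
move: (N2 y) (gz y) => b c h0.
by field.
Qed.

Lemma emb_nrm y : U y -> ip emb nrm y = 0.
Proof.
move=> Uy; rewrite /ip /emb /nrm mvec_dot /mx /mq /mp.
have -> : \sum_k Y k y * (eps * (kap y * G k y)) =
   eps * kap y * (\sum_k X k y * G k y - shr y * N2 y).
  rewrite mulr_sumr -sumrB mulr_sumr; apply: eq_bigr => k _; rewrite /Y; ring.
rewrite /q /p /tau.
have := k0 Uy; rewrite /shr /kap.
move: (\sum_a X a y * G a y) (N2 y) (gz y) (z y) => a b c d h0.
by field.
Qed.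

Lemma demb_nrm i y : U y -> ip (fun a => pd i (emb a)) nrm y = 0.
Proof.
move=> Uy; rewrite /ip (eq_mip (fun a => pd_emb i a Uy) (fun a => erefl)) mvec_dot.
rewrite /mx /mq /mp !(pd_q _ Uy) !(pd_p _ Uy).
have -> : \sum_k pd i (Y k) y * (eps * (kap y * G k y)) =
   eps * kap y * (\sum_k frx i k y * G k y - eps * kap y * frz i y * N2 y).
  rewrite mulr_sumr -sumrB mulr_sumr; apply: eq_bigr => k _; rewrite (pd_Y i k Uy); ring.
have := k0 Uy; rewrite /kap.
move: (\sum_a frx i a y * G a y) (N2 y) (gz y) (frz i y) => a b c d h0.
by field.
Qed.

(** The derivative of [nrm] is eps kappa times the image of (dG, dgz) under the isometry that gives
    the derivative of [emb]. *)
Lemma emb_sff i j y : U y ->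
  sff emb nrm i j y = eps * kap y *
    (\sum_a frx j a y * pd i (G a) y + frz j y * pd i gz y).
Proof.
move=> Uy; rewrite /sff /ip (eq_mip (fun a => pd_emb j a Uy) (fun a => pd_nrm i a Uy)) mvec_dot.
rewrite !(pd_q _ Uy) !(pd_p _ Uy).
rewrite (elem_pdN oU i elem_kap Uy) (elem_pdD oU i Ekg EkN Uy).
rewrite (elem_pdD oU i (Ec 1) (elemM (Ec eps) Eg) Uy) pd_cst (pd_Zl eps i Eg Uy).
rewrite (pd_Zl _ i (elemM elem_kap EN2) Uy) (elem_pdM oU i elem_kap EN2 Uy).
rewrite (pd_N2 i Uy) (pd_kap i Uy).
have -> : \sum_k pd j (Y k) y * pd i (mx k) y =
  eps * kap y * (\sum_a frx j a y * pd i (G a) y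
    - eps * kap y * frz j y * \sum_a G a y * pd i (G a) y)
  - (eps * kap y) ^+ 2 * pd i gz y * (\sum_a frx j a y * G a y - eps * kap y * frz j y * N2 y).
  rewrite !mulr_sumr -!sumrB !mulr_sumr -sumrB; apply: eq_bigr => k _.
  rewrite (pd_Y j k Uy) (pd_Zl _ i (elemM elem_kap (EG k)) Uy).
  rewrite (elem_pdM oU i elem_kap (EG k) Uy) (pd_kap i Uy).
  move: (frx j k y) (frz j y) (pd i gz y) (pd i (G k) y) (kap y) (G k y) => a b c d e h; ring.
have := k0 Uy; rewrite /kap.
move: (\sum_a frx j a y * G a y) (\sum_a G a y * pd i (G a) y) (\sum_a frx j a y * pd i (G a) y).
move: (N2 y) (gz y) (frz j y) (pd i gz y) => a b c d e h m h0.
by field.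
Qed.

Lemma elem_defm i j : elem U (defm i j).
Proof.
have Ef k a : elem U (frx k a).
  apply: elemB; first exact: elem_pd.
  by apply: elemM; [exact: elem_shr|exact: elem_pd].
have Efz k : elem U (frz k).
  apply: elemB; first exact: elem_pd.
  by apply: elemM; [exact: elem_shr|exact: elem_pd].
by apply: elemD; [apply: elem_sum => a|]; exact: elemM.
Qed.

End Embedding.

Section OpenElem.
Context {R : realType} {n : nat}.
Local Notation V := 'rV[R]_n.
Implicit Types (U : set V) (f : V -> R).

Lemma open_elem_neq0 U f : open U -> elem U f -> open (U `&` [set y | f y != 0]).
Proof.
move=> oU Ef; rewrite openE => x [Ux fx]; apply: filterI.
  exact: open_nbhs_nbhs.
exact: (cvgr_neq0 _ (elem_continuous oU Ef Ux)).
Qed.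

Lemma open_elem_gt0 U f : open U -> elem U f -> open (U `&` [set y | 0 < f y]).
Proof.
move=> oU Ef; rewrite openE => x [Ux fx]; apply: filterI.
  exact: open_nbhs_nbhs.
exact: (@cvgr_gt _ _ _ _ _ _ (elem_continuous oU Ef Ux) _ fx).
Qed.

Lemma elem_sqnorm U : elem U (@sqnorm R n).
Proof. by apply: elem_sum => i; apply: elemX; exact: elem_coord. Qed.

Lemma pd_sqnorm i y : pd i (@sqnorm R n) y = 2 * y 0 i.
Proof.
have oT : open [set: V] by exact: openT.
rewrite /sqnorm (elem_pd_sum oT)//; last first.
  by move=> k; apply: elemX; exact: elem_coord.
rewrite (bigD1 i)//= big1 ?addr0 => [|k ki].
  rewrite (pd_ext (g := fun y : V => y 0 i * y 0 i) i oT) => [|//|z _]; last by rewrite expr2.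
  rewrite (elem_pdM oT i (elem_coord _ i) (elem_coord _ i))// pd_coord eqxx mulr1.
  by rewrite -mulr2n mulr_natl.
rewrite (pd_ext (g := fun y : V => y 0 k * y 0 k) i oT) => [|//|z _]; last by rewrite expr2.
rewrite (elem_pdM oT i (elem_coord _ k) (elem_coord _ k))// pd_coord eq_sym (negbTE ki).
by rewrite mulr0 addr0.
Qed.

End OpenElem.

(** * Scalar curvature of the deformed metrics *)

Section ScalDefm.
Context {R : realType} {n : nat}.
Local Notation V := 'rV[R]_n.
Variables (X G : 'I_n -> V -> R) (z gz : V -> R) (eps : R).
Variables (U : set V) (oU : open U).
Hypothesis EX : forall a, elem U (X a).
Hypothesis EG : forall a, elem U (G a).
Hypothesis Ez : elem U z.
Hypothesis Eg : elem U gz.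
Hypothesis XX : forall y, U y -> \sum_a X a y * X a y = 1 - z y * z y.
Hypothesis XdG : forall i y, U y -> \sum_a X a y * pd i (G a) y = - (z y * pd i gz y).
Hypothesis k0 : forall y, U y -> 1 + eps * gz y != 0.

Lemma scal_defm x : U x -> \det (gmx (defm X G z gz eps) x) != 0 ->
  let W := invmx (gmx (defm X G z gz eps) x) *m
    \matrix_(i, j) (eps * kap gz eps x *
      (\sum_a frx X G z gz eps j a x * pd i (G a) x + frz z gz eps j x * pd i gz x)) in
  scal (defm X G z gz eps) x = n%:R * (n%:R - 1) - (\tr W) ^+ 2 + \tr (W *m W).
Proof.
move=> Ux d0; set g := defm X G z gz eps.
have Edet : elem U (fun y => \det (gmx g y)).
  apply: elem_det => i j; apply: elem_ext (elem_defm oU EX EG Ez Eg k0 i j) _ => y _.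
  by rewrite mxE.
(* Nondegeneracy is given at [x] only, but it is an open condition. *)
pose U' := U `&` [set y | \det (gmx g y) != 0].
have oU' : open U' by exact: open_elem_neq0.
have sU : U' `<=` U by move=> y [].
have U'x : U' x by [].
have EF a := elem_subset sU (elem_emb EX EG Ez Eg k0 a).
have Em a := elem_subset sU (elem_nrm EG Eg k0 a).
pose F := emb X G z gz eps; pose m := nrm G gz eps.
have h1 y : U' y -> ip F F y = 1 by move=> /sU; exact: emb_unit.
have h2 y : U' y -> ip m m y = -1 by move=> /sU; exact: nrm_unit.
have h3 y : U' y -> ip F m y = 0 by move=> /sU; exact: emb_nrm.
have h4 i y : U' y -> ip (fun a => pd i (F a)) m y = 0.
  by move=> /sU; exact: (demb_nrm oU EX EG Ez Eg XdG k0).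
have h5 y : U' y -> forall i j, g i j y = ip (fun a => pd i (F a)) (fun a => pd j (F a)) y.
  by move=> /sU Uy i j; exact: (emb_metric oU EX EG Ez Eg XdG k0).
have h6 y : U' y -> \det (gmx g y) != 0 by case.
have H := scal_hypersurface oU' EF Em h5 h6 h1 h2 h3 h4 U'x.
move=> W; move: H => /=.
have -> : \matrix_(i, j) sff F m i j x = \matrix_(i, j) (eps * kap gz eps x *
  (\sum_a frx X G z gz eps j a x * pd i (G a) x + frz z gz eps j x * pd i gz x)).
  by apply/matrixP => i j; rewrite !mxE; exact: (emb_sff oU EX EG Ez Eg XdG k0 i j Ux).
by [].
Qed.

End ScalDefm.

(** * Mean curvature of the unit sphere for a metric with radial first derivatives *)

Section MeanCurvature.
Context {R : realType} {n : nat}.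
Local Notation V := 'rV[R]_n.
Variables (g : @metric_field R n) (U : set V) (oU : open U).
Hypothesis Eg : forall i j, elem U (g i j).
Variables (x : V) (M : 'I_n -> 'I_n -> R).
Hypothesis Ux : U x.
Hypothesis nx : sqnorm x = 1.
Hypothesis gx : forall i j, g i j x = (i == j)%:R.
Hypothesis pdg : forall m i j, pd m (g i j) x = x 0 m * M i j.
Hypothesis MC : forall i j, M i j = M j i.
Implicit Types i j k l : 'I_n.

Let gmx1 : gmx g x = 1%:M.
Proof. by apply/matrixP => i j; rewrite !mxE gx. Qed.

Let U1 := U `&` [set y | \det (gmx g y) != 0].

Let oU1 : open U1.
Proof.
apply: open_elem_neq0 => //; apply: elem_det => i j.
by apply: elem_ext (Eg i j) _ => y _; rewrite mxE.
Qed.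

Let U1x : U1 x. Proof. by split => //=; rewrite gmx1 det1 oner_neq0. Qed.

Let Eg1 i j : elem U1 (g i j). Proof. by apply: elem_subset (Eg i j) => y []. Qed.

Let Egi k l : elem U1 (fun y => ginv g y k l).
Proof.
apply: elem_invmx => [i j|y [] //].
by apply: elem_ext (Eg1 i j) _ => y _; rewrite mxE.
Qed.

Let ginvx k l : ginv g x k l = (k == l)%:R.
Proof. by rewrite /ginv gmx1 invmx1 mxE. Qed.

Let sum_delta (f : 'I_n -> R) k : \sum_l (k == l)%:R * f l = f k.
Proof.
rewrite (bigD1 k)//= eqxx mul1r big1 ?addr0// => l lk.
by rewrite eq_sym (negbTE lk) mul0r.
Qed.

Let pd_ginvx m k l : pd m (fun y => ginv g y k l) x = - (x 0 m * M k l).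
Proof.
have H : \sum_q (pd m (fun y => ginv g y k q) x * g q l x
                + ginv g x k q * pd m (g q l) x) = 0.
  transitivity (pd m (fun y => \sum_q ginv g y k q * g q l y) x).
    rewrite (elem_pd_sum oU1)//; last by move=> q; exact: elemM.
    apply: eq_bigr => q _; rewrite (elem_pdM oU1 m (Egi k q) (Eg1 q l) U1x).
    by rewrite addrC [X in _ + X = _]mulrC.
  rewrite (pd_ext (g := fun=> (k == l)%:R) m oU1 U1x) ?pd_cst// => y [_ d0].
  have := @mulVmx _ _ (gmx g y); rewrite unitmxE unitfE d0 => /(_ isT).
  move/matrixP => /(_ k l); rewrite !mxE => <-.
  by apply: eq_bigr => q _; rewrite !mxE.
move: H; rewrite big_split /=.
under [X in _ + X]eq_bigr => q _ do rewrite ginvx pdg.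
rewrite sum_delta.
under eq_bigr => q _ do rewrite gx mulrC eq_sym.
by rewrite sum_delta => H; apply/eqP; rewrite -addr_eq0 H.
Qed.

Let sx : \sum_i x 0 i * x 0 i = 1.
Proof. by rewrite -[RHS]nx; apply: eq_bigr => i _; rewrite expr2. Qed.

Let Q y := \sum_i \sum_j ginv g y i j * pd i sqnorm y * pd j sqnorm y.

Let Epd k : elem U1 (pd k sqnorm).
Proof. by apply: elem_pd => //; exact: elem_sqnorm. Qed.

Let EQ : elem U1 Q.
Proof.
apply: elem_sum => i; apply: elem_sum => j.
by apply: elemM; first exact: elemM.
Qed.

Let Qx : Q x = 4.
Proof.
rewrite /Q; under eq_bigr => i _ do (under eq_bigr => j _ do
  rewrite ginvx !pd_sqnorm -mulrA; rewrite sum_delta).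
have -> : 4 = 4 * \sum_i x 0 i * x 0 i by rewrite sx mulr1.
rewrite mulr_sumr; apply: eq_bigr => i _; ring.
Qed.

Let U2 := U1 `&` [set y | 0 < Q y].

Let oU2 : open U2. Proof. exact: open_elem_gt0. Qed.
Let U2x : U2 x. Proof. by split => //=; rewrite Qx. Qed.

Let E2 f : elem U1 f -> elem U2 f. Proof. by apply: elem_subset => y []. Qed.

Let W k y := \sum_j ginv g y k j * pd j sqnorm y.

Let EW k : elem U1 (W k). Proof. by apply: elem_sum => j; exact: elemM. Qed.

Let Wx k : W k x = 2 * x 0 k.
Proof. by rewrite /W; under eq_bigr => j _ do rewrite ginvx pd_sqnorm; rewrite sum_delta. Qed.

Let pdW i k : pd i (W k) x = 2 * ((i == k)%:R - x 0 i * \sum_j M k j * x 0 j).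
Proof.
rewrite (elem_pd_sum oU1)//; last by move=> q; exact: elemM.
under eq_bigr => j _ do rewrite (elem_pdM oU1 i (Egi k j) (Epd j) U1x) ginvx pd_ginvx
  (pd_ext (g := fun y : V => 2 * y 0 j) i oU1 U1x (fun y _ => pd_sqnorm j y))
  (elem_pdM oU1 i (elem_cst U1 2) (elem_coord U1 j) U1x) pd_cst mulr0 addr0 pd_coord pd_sqnorm.
rewrite big_split /= sum_delta mulrBr; congr (_ + _).
rewrite !mulr_sumr -sumrN; apply: eq_bigr => j _; ring.
Qed.

(** The inverse length of the gradient, as a real power rather than by [Num.sqrt], so that it
    belongs to [elem]. *)
Let S y := (Q y `^ 2^-1)^-1.

Let ES : elem U2 S.
Proof.
apply: elemV => [|y [_ Qy]]; last by rewrite gt_eqF// powR_gt0.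
by apply: elem_powR => [|y []//]; exact: E2.
Qed.

Let nuE k y : U2 y -> nu g k y = W k y * S y.
Proof. by move=> [_ Qy]; rewrite /nu /S powR12_sqrt// ltW. Qed.

Let Sx : S x = 2^-1.
Proof.
rewrite /S powR12_sqrt ?Qx//; congr (_^-1).
by rewrite (_ : 4 = 2 ^+ 2) ?sqrtr_sqr ?ger0_norm// expr2 -natrM.
Qed.

Let nux k : nu g k x = x 0 k.
Proof. by rewrite nuE// Sx Wx; field. Qed.

(** The derivative of the normalization [S] is left unevaluated: it only adds a multiple of the
    normal, which the projection onto the tangent space removes. *)
Let pd_nu i k : pd i (nu g k) x =
  (i == k)%:R - x 0 i * (\sum_j M k j * x 0 j) + 2 * x 0 k * pd i S x.
Proof.
rewrite (pd_ext i oU2 U2x (nuE k)) (elem_pdM oU2 i (E2 (EW k)) ES U2x).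
by rewrite Wx Sx pdW; move: (pd i S x) (\sum_j _) => a b; field.
Qed.

Let christx k i l : christ g k i l x = 2^-1 * (x 0 i * M k l + x 0 l * M i k - x 0 k * M i l).
Proof.
rewrite /christ; under eq_bigr => q _ do rewrite ginvx; rewrite sum_delta !pdg.
by rewrite (MC l k).
Qed.

(** The value n - 1 of the Euclidean unit sphere, plus half the radial derivative of the metric
    traced over the tangent space. *)
Lemma mean_curv_unit_sphere : mean_curv g x =
  n%:R - 1 + 2^-1 * (\sum_i M i i - \sum_i \sum_j x 0 i * x 0 j * M i j).
Proof.
rewrite /mean_curv.
pose b k := \sum_j M k j * x 0 j.
have e i j : \sum_k g j k x * (pd i (nu g k) x + \sum_l christ g k i l x * nu g l x) =
  (i == j)%:R + 2^-1 * M i j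
  + x 0 j * (2 * pd i S x - 2^-1 * b i) - 2^-1 * x 0 i * b j.
  under eq_bigr => k _ do rewrite gx; rewrite sum_delta pd_nu -/(b j).
  have -> : \sum_l christ g j i l x * nu g l x =
     2^-1 * (x 0 i * b j + M i j * \sum_l x 0 l * x 0 l - x 0 j * b i).
    rewrite /b !mulr_sumr -big_split -sumrB mulr_sumr; apply: eq_bigr => l _ /=.
    rewrite christx nux; ring.
  by rewrite sx; move: (pd i S x) (b i) (b j) => p q r; field.
under eq_bigr => i _ do under eq_bigr => j _ do rewrite e ginvx !nux.
have xb : \sum_i x 0 i * b i = \sum_i \sum_j x 0 i * x 0 j * M i j.
  by apply: eq_bigr => i _; rewrite mulr_sumr; apply: eq_bigr => j _; ring.
transitivity (\sum_i (\sum_j (i == j)%:R * ((i == j)%:R + 2^-1 * M i j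
    + x 0 j * (2 * pd i S x - 2^-1 * b i) - 2^-1 * x 0 i * b j)
  - \sum_j (x 0 i * ((i == j)%:R * x 0 j) + 2^-1 * (x 0 i * x 0 j * M i j)
    + (x 0 j * x 0 j) * (x 0 i * (2 * pd i S x - 2^-1 * b i))
    - 2^-1 * (x 0 i * x 0 i) * (x 0 j * b j)))).
  apply: eq_bigr => i _; rewrite -sumrB; apply: eq_bigr => j _.
  move: (pd i S x) (b i) (b j) => p q r; ring.
transitivity (\sum_i (1 + 2^-1 * M i i - 2^-1 * (x 0 i * b i) - x 0 i * x 0 i
   - 2^-1 * (\sum_j x 0 i * x 0 j * M i j) + x 0 i * x 0 i * (2^-1 * \sum_j x 0 j * b j))).
  apply: eq_bigr => i _; rewrite sum_delta eqxx !sumrB !big_split /=.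
  rewrite -!mulr_sumr -mulr_suml sx sum_delta.
  by move: (pd i S x) (b i) (\sum_j x 0 j * b j) (\sum_j _ * M i j) => p q r s; field.
rewrite !(big_split, sumrN) /= -mulr_suml -!mulr_sumr sx xb.
rewrite sumr_const card_ord.
by move: (\sum_i M i i) (\sum_i \sum_j _) => p q; field.
Qed.

End MeanCurvature.

(** * The deformed metric and its curvature in an orthonormal frame *)

Section Frame.
Context {R : realType} {n : nat}.
Local Notation V := 'rV[R]_n.
Variables (X G : 'I_n -> V -> R) (z gz : V -> R) (eps : R) (x : V).
Variables (f : R) (E : 'M[R]_n) (Ez : 'cV[R]_n) (A : 'M[R]_n).
Hypothesis f0 : f != 0.
Hypothesis EE : E *m E^T + Ez *m Ez^T = 1%:M.
Hypothesis pdX : forall i a, pd i (X a) x = f * E i a.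
Hypothesis pdz : forall i, pd i z x = f * Ez i 0.
Hypothesis pdG : forall i a, pd i (G a) x = f * (A *m E) i a.
Hypothesis pdgz : forall i, pd i gz x = f * (A *m Ez) i 0.
Hypothesis AC : A^T = A.

Let s := shr z gz eps x.
Definition smx := 1%:M - s *: A.

Let mx_subZ k l (P Q : 'M[R]_(k, l)) b i j : (P - b *: Q) i j = P i j - b * Q i j.
Proof. by rewrite !mxE. Qed.

Let frxE i a : frx X G z gz eps i a x = f * (smx *m E) i a.
Proof.
by rewrite /frx pdX pdG -/s /smx mulmxBl mul1mx -scalemxAl mx_subZ; ring.
Qed.

Let frzE i : frz z gz eps i x = f * (smx *m Ez) i 0.
Proof.
by rewrite /frz pdz pdgz -/s /smx mulmxBl mul1mx -scalemxAl mx_subZ; ring.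
Qed.

Let smxT : smx^T = smx.
Proof. by rewrite /smx linearB /= linearZ /= AC trmx1. Qed.

Let gram (P Q : 'M[R]_n) i j :
  \sum_a (P *m E) i a * (Q *m E) j a + (P *m Ez) i 0 * (Q *m Ez) j 0 = (P *m Q^T) i j.
Proof.
have -> : P *m Q^T = (P *m E) *m (Q *m E)^T + (P *m Ez) *m (Q *m Ez)^T.
  rewrite !trmx_mul !mulmxA -(mulmxA P) -[P *m Ez *m _](mulmxA P) -mulmxDl -mulmxDr.
  by rewrite EE mulmx1.
rewrite [RHS]mxE [X in _ = X + _]mxE [X in _ = _ + X]mxE big_ord1; congr (_ + _).
  by apply: eq_bigr => a _; rewrite [X in _ = _ * X]mxE.
by rewrite [X in _ = _ * X]mxE.
Qed.

(** The rows of (E, Ez) are orthonormal, and d(X, z) - s d(G, gz) = f (1 - s A) (E, Ez). *)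
Lemma gmx_defm : gmx (defm X G z gz eps) x = f ^+ 2 *: (smx *m smx).
Proof.
apply/matrixP => i j; rewrite mxE [RHS]mxE -{2}smxT -gram mulrDr mulr_sumr.
rewrite /defm; congr (_ + _).
  by apply: eq_bigr => a _; rewrite !frxE; ring.
by rewrite !frzE; ring.
Qed.

Lemma sff_defm : \matrix_(i, j) (eps * kap gz eps x *
      (\sum_a frx X G z gz eps j a x * pd i (G a) x + frz z gz eps j x * pd i gz x))
  = (eps * kap gz eps x * f ^+ 2) *: (A *m smx).
Proof.
apply/matrixP => i j; rewrite mxE [RHS]mxE -{1}smxT -gram -[RHS]mulrA; congr (_ * _).
rewrite mulrDr mulr_sumr; congr (_ + _).
  by apply: eq_bigr => a _; rewrite !frxE pdG; ring.
by rewrite !frzE pdgz; ring.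
Qed.

Lemma defm_unit : smx \in unitmx -> gmx (defm X G z gz eps) x \in unitmx.
Proof.
move=> Su; rewrite gmx_defm unitmxE detZ det_mulmx !unitrM -!unitmxE Su !andbT.
by rewrite unitrX ?unitfE ?expf_neq0.
Qed.

(** The Weingarten map is eps kappa (1 - s A)^-2 A (1 - s A) by [gmx_defm] and [sff_defm], and A
    commutes with 1 - s A. *)
Lemma scal_frame (U : set V) : open U -> U x ->
  (forall a, elem U (X a)) -> (forall a, elem U (G a)) -> elem U z -> elem U gz ->
  (forall y, U y -> \sum_a X a y * X a y = 1 - z y * z y) ->
  (forall i y, U y -> \sum_a X a y * pd i (G a) y = - (z y * pd i gz y)) ->
  (forall y, U y -> 1 + eps * gz y != 0) ->
  smx \in unitmx ->
  let B := invmx smx *m A in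
  scal (defm X G z gz eps) x =
    n%:R * (n%:R - 1) + (eps * kap gz eps x) ^+ 2 * (\tr (B *m B) - \tr B ^+ 2).
Proof.
move=> oU Ux EX EG Ezz Eg XX XdG k0 Su B.
have gu := defm_unit Su.
have d0 : \det (gmx (defm X G z gz eps) x) != 0 by rewrite -unitfE -unitmxE.
rewrite (scal_defm oU EX EG Ezz Eg XX XdG k0 Ux d0) sff_defm gmx_defm.
set c := eps * kap gz eps x.
have comm : A *m smx = smx *m A.
  by rewrite /smx mulmxBl mulmxBr mulmx1 mul1mx -scalemxAl -scalemxAr.
have f2 : f ^+ 2 \is a GRing.unit by rewrite unitfE expf_neq0.
have -> : invmx (f ^+ 2 *: (smx *m smx)) *m ((c * f ^+ 2) *: (A *m smx)) = c *: B.
  rewrite comm.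
  have -> : (c * f ^+ 2) *: (smx *m A) = (f ^+ 2 *: (smx *m smx)) *m (c *: B).
    rewrite /B -scalemxAr -scalemxAl scalerA; congr (_ *: _).
    by rewrite -mulmxA mulKVmx.
  rewrite mulKmx // unitmxE detZ det_mulmx !unitrM -!unitmxE Su !andbT.
  by rewrite (unitrX n f2).
rewrite -scalemxAl -scalemxAr !mxtraceZ.
by move: (\tr B) (\tr (B *m B)) => p q; ring.
Qed.

(** The quadratic form is f^2 times the squared length of v (1 - s A), and 1 - s A is invertible. *)
Lemma defm_posdef (v : V) : smx \in unitmx -> v != 0 ->
  0 < \sum_i \sum_j v 0 i * v 0 j * defm X G z gz eps i j x.
Proof.
move=> Su v0.
have -> : \sum_i \sum_j v 0 i * v 0 j * defm X G z gz eps i j x =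
   f ^+ 2 * \sum_k (v *m smx) 0 k ^+ 2.
  transitivity ((v *m gmx (defm X G z gz eps) x *m v^T) 0 0).
    rewrite mxE exchange_big; apply: eq_bigr => j _ /=; rewrite mxE mulr_suml.
    by apply: eq_bigr => i _; rewrite !mxE; ring.
  rewrite gmx_defm -scalemxAr -scalemxAl mxE; congr (_ * _).
  have e : smx *m v^T = (v *m smx)^T by rewrite trmx_mul smxT.
  rewrite mulmxA -(mulmxA (v *m smx)) e mxE.
  by apply: eq_bigr => k _; rewrite [(_^T) k 0]mxE expr2.
rewrite mulr_gt0// ?exprn_even_gt0// lt0r sumr_ge0 ?andbT => [|k _]; last exact: sqr_ge0.
apply/negP; rewrite psumr_eq0 => [/allP H|k _]; last exact: sqr_ge0.
have vS : v *m smx = 0.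
  apply/rowP => k; have := H k (mem_index_enum k); rewrite implyTb sqrf_eq0 => /eqP ->.
  by rewrite mxE.
by move: v0; rewrite -(mulmxK Su v) vS mul0mx eqxx.
Qed.

End Frame.

(** * Traces of a multiple of the identity perturbed by two rank-one terms *)

Section RankTwo.
Variables (R : comNzRingType) (n : nat) (lam p q : R) (t u : 'I_n -> R).

Definition rank2 : 'M[R]_n :=
  \matrix_(i, j) (lam * (i == j)%:R - p * (t i * t j) - q * (u i * u j)).

Lemma tr_rank2 : \tr rank2 =
  n%:R * lam - p * \sum_i t i * t i - q * \sum_i u i * u i.
Proof.
have -> : n%:R * lam = \sum_(i < n) lam by rewrite sumr_const card_ord mulr_natl.
by rewrite /mxtrace !mulr_sumr -!sumrB; apply: eq_bigr => i _; rewrite mxE eqxx mulr1.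
Qed.

Lemma quad_rank2 (w : 'I_n -> R) : \sum_i w i * \sum_j w j * rank2 j i = lam * \sum_i w i * w i
   - p * (\sum_j t j * w j) ^+ 2 - q * (\sum_j u j * w j) ^+ 2.
Proof.
have H i : \sum_j w j * rank2 j i =
   lam * w i - p * (\sum_j t j * w j) * t i - q * (\sum_j u j * w j) * u i.
  under eq_bigr => j _ do rewrite mxE.
  transitivity (\sum_j (lam * (w j * (j == i)%:R) - p * (t j * w j) * t i - q * (u j * w j) * u i)).
    by apply: eq_bigr => j _; ring.
  rewrite !sumrB -!mulr_suml -!mulr_sumr; congr (lam * _ - _ - _).
  rewrite (bigD1 i)//= eqxx mulr1 big1 ?addr0// => j ji.
  by rewrite (negbTE ji) mulr0.
under eq_bigr => i _ do rewrite H.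
  rewrite !expr2 !mulrA [in RHS]mulr_sumr [in X in _ = _ - X - _]mulr_sumr.
  rewrite [in X in _ = _ - _ - X]mulr_sumr -!sumrB; apply: eq_bigr => i _; ring.
Qed.

Lemma tr_rank2_sqr : \tr (rank2 *m rank2) =
  n%:R * lam ^+ 2 - 2 * lam * (p * \sum_i t i * t i + q * \sum_i u i * u i)
  + p ^+ 2 * (\sum_i t i * t i) ^+ 2 + q ^+ 2 * (\sum_i u i * u i) ^+ 2
  + 2 * p * q * (\sum_i t i * u i) ^+ 2.
Proof.
have -> : \tr (rank2 *m rank2) = lam * \tr rank2
   - p * (\sum_i t i * \sum_j t j * rank2 j i) - q * (\sum_i u i * \sum_j u j * rank2 j i).
  rewrite /mxtrace !mulr_sumr -!sumrB; apply: eq_bigr => i _.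
  rewrite mxE !mulr_sumr; under eq_bigr => j _ do rewrite [rank2 i j]mxE !mulrBl.
  rewrite !sumrB; congr (_ - _ - _).
  - rewrite (bigD1 i)//= eqxx mulr1 big1 ?addr0// => j ji.
    by rewrite eq_sym (negbTE ji) mulr0 mul0r.
  - by apply: eq_bigr => j _; ring.
  - by apply: eq_bigr => j _; ring.
rewrite !quad_rank2 tr_rank2.
have -> : \sum_j u j * t j = \sum_j t j * u j by apply: eq_bigr => j _; rewrite mulrC.
move: (\sum_i t i * t i) (\sum_i u i * u i) (\sum_i t i * u i) => a b c; ring.
Qed.

Lemma tr_rank2C : rank2^T = rank2.
Proof. by apply/matrixP => i j; rewrite !mxE eq_sym (mulrC (t j)) (mulrC (u j)). Qed.

End RankTwo.

(** * The potential *)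

Section Potential.
Context {R : realType} {n : nat}.
Local Notation V := 'rV[R]_n.
Variables (i0 : 'I_n) (d a C : R).
Hypothesis a1 : 1 - a != 0.
Implicit Types (i j k : 'I_n) (y : V).

(* Inverse stereographic projection [(stX, stz)] of conformal factor [stf]. *)
Definition stf y : R := 2 * (1 + sqnorm y)^-1.
Definition stX k y : R := stf y * y 0 k.
Definition stz y : R := stf y - 1.
Definition vf y : R := 1 + d ^+ 2 - stX i0 y ^+ 2 + 2 * d * stz y.
(* [Lf y] is L (v) and [Lp y] is L' (v) at v = [vf y], while [Hp y] below is - 4 L'' (v). *)
Definition Lp y : R := vf y `^ (- a).
Definition Lf y : R := C + (1 - a)^-1 * vf y `^ (1 - a).
(** Coefficient of the position vector in the gradient of the homogeneous extension: tau minus the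
    radial part 2 (d z - xi^2) L' of the gradient of L (v). It is also the multiple of the identity
    in [hessA]. *)
Definition lamf y : R := Lf y + 2 * (Lp y * (stX i0 y ^+ 2 - d * stz y)).
Definition gradx k y : R := lamf y * stX k y - 2 * (k == i0)%:R * (Lp y * stX i0 y).
Definition gradz y : R := lamf y * stz y + 2 * d * Lp y.

(* Orthonormal frame of the sphere: the derivatives of [(stX, stz)] divided by [stf]. *)
Definition stE y : 'M[R]_n := \matrix_(k, l) ((k == l)%:R - y 0 k * stX l y).
Definition stEz y : 'cV[R]_n := \col_k - (stf y * y 0 k).
Definition uvec y k : R := stE y k i0.
Definition tvec y k : R := stX i0 y * uvec y k - d * stEz y k 0.
Definition Hp y : R := 4 * a * vf y `^ (- a - 1).
(* Hess tau + tau id in that frame; [uvec] and [tvec] are the gradients of xi and - v / 2. *)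
Definition hessA y : 'M[R]_n := rank2 (lamf y) (Hp y) (2 * Lp y) (tvec y) (uvec y).

Definition vdom : set V := [set y | 0 < vf y].

Let Tt := [set: V].
Let oT : open Tt := openT.

Lemma sqnorm_ge0 y : 0 <= sqnorm y.
Proof. by apply: sumr_ge0 => k _; exact: sqr_ge0. Qed.

Lemma denom_gt0 y : 0 < 1 + sqnorm y.
Proof. by have := sqnorm_ge0 y; lra. Qed.

Let dn0 y : 1 + sqnorm y != 0. Proof. by rewrite gt_eqF ?denom_gt0. Qed.

Lemma stf_gt0 y : 0 < stf y.
Proof. by rewrite mulr_gt0 ?invr_gt0 ?denom_gt0. Qed.

Lemma elem_stf U : elem U stf.
Proof.
apply: elemM; first exact: elem_cst; apply: elemV => [|y _]; last exact: dn0.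
by apply: elemD; [exact: elem_cst|exact: elem_sqnorm].
Qed.

Lemma elem_stX U k : elem U (stX k).
Proof. by apply: elemM; [exact: elem_stf|exact: elem_coord]. Qed.

Lemma elem_stz U : elem U stz.
Proof. by apply: elemB; [exact: elem_stf|exact: elem_cst]. Qed.

Lemma elem_vf U : elem U vf.
Proof.
apply: elemD; last by apply: elemM; [exact: elem_cst|exact: elem_stz].
by apply: elemB; [exact: elem_cst|apply: elemX; exact: elem_stX].
Qed.

Lemma open_vdom : open vdom.
Proof. by have := open_elem_gt0 oT (elem_vf Tt); rewrite setTI. Qed.

Let vd y : vdom y -> 0 < vf y. Proof. by []. Qed.

Lemma elem_Lp : elem vdom Lp.
Proof. by apply: elem_powR => //; exact: elem_vf. Qed.

Lemma elem_Lf : elem vdom Lf.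
Proof.
apply: elemD; first exact: elem_cst; apply: elemM; first exact: elem_cst.
by apply: elem_powR => //; exact: elem_vf.
Qed.

Let EXdz U : elem U (fun y => stX i0 y ^+ 2 - d * stz y).
Proof.
apply: elemB; first by apply: elemX; exact: elem_stX.
by apply: elemM; [exact: elem_cst|exact: elem_stz].
Qed.

Lemma elem_lamf : elem vdom lamf.
Proof.
apply: elemD; first exact: elem_Lf; apply: elemM; first exact: elem_cst.
by apply: elemM; [exact: elem_Lp|exact: EXdz].
Qed.

Lemma elem_gradx k : elem vdom (gradx k).
Proof.
apply: elemB; first by apply: elemM; [exact: elem_lamf|exact: elem_stX].
apply: elemM; first exact: elem_cst.
by apply: elemM; [exact: elem_Lp|exact: elem_stX].
Qed.

Lemma elem_gradz : elem vdom gradz.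
Proof.
apply: elemD; first by apply: elemM; [exact: elem_lamf|exact: elem_stz].
by apply: elemM; [exact: elem_cst|exact: elem_Lp].
Qed.

Lemma stf_sqnorm y : stf y * (1 + sqnorm y) = 2.
Proof. by rewrite /stf mulfVK. Qed.

Lemma sum_sqr y : \sum_k y 0 k * y 0 k = sqnorm y.
Proof. by apply: eq_bigr => k _; rewrite expr2. Qed.

Lemma stX_sqr y : \sum_k stX k y * stX k y = 1 - stz y * stz y.
Proof.
have -> : \sum_k stX k y * stX k y = stf y ^+ 2 * sqnorm y.
  by rewrite -sum_sqr mulr_sumr; apply: eq_bigr => k _; rewrite /stX; ring.
rewrite /stz /stf; move: (dn0 y) => h; by field.
Qed.

(** Stereographic projection is conformal with factor [stf]. *)
Lemma frame_gram y : stE y *m (stE y)^T + stEz y *m (stEz y)^T = 1%:M.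
Proof.
apply/matrixP => k l; rewrite mxE [X in X + _]mxE [X in _ + X]mxE big_ord1 !mxE.
under eq_bigr => j _ do rewrite !mxE.
have -> : \sum_j ((k == j)%:R - y 0 k * stX j y) * ((l == j)%:R - y 0 l * stX j y) =
  \sum_j ((k == j)%:R * (l == j)%:R - (k == j)%:R * (y 0 l * stX j y)
          - (l == j)%:R * (y 0 k * stX j y) + y 0 k * y 0 l * (stX j y * stX j y)).
  by apply: eq_bigr => j _; ring.
rewrite big_split !sumrB /= -mulr_sumr stX_sqr.
have sd (f : 'I_n -> R) m : \sum_j (m == j)%:R * f j = f m.
  rewrite (bigD1 m)//= eqxx mul1r big1 ?addr0// => j jm.
  by rewrite eq_sym (negbTE jm) mul0r.
rewrite !sd (eq_sym l) /stX /stz; set e := (k == l)%:R.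
have := stf_sqnorm y; rewrite /stf; move: (dn0 y) (y 0 k) (y 0 l) => h p q _; by field.
Qed.

Lemma frame_tangent y k : \sum_l stX l y * stE y k l + stz y * stEz y k 0 = 0.
Proof.
under eq_bigr => l _ do rewrite mxE.
have -> : \sum_l stX l y * ((k == l)%:R - y 0 k * stX l y) =
   stX k y - y 0 k * (1 - stz y * stz y).
  rewrite -stX_sqr mulr_sumr -[X in X - _](_ : \sum_l stX l y * (k == l)%:R = _).
    by rewrite -sumrB; apply: eq_bigr => l _; ring.
  rewrite (bigD1 k)//= eqxx mulr1 big1 ?addr0// => j jm.
  by rewrite eq_sym (negbTE jm) mulr0.
rewrite mxE /stX /stz; ring.
Qed.

Lemma pd_stf i y : pd i stf y = - (stf y ^+ 2 * y 0 i).
Proof.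
have Ed : elem Tt (fun y : V => 1 + sqnorm y) := elemD (elem_cst _ 1) (elem_sqnorm _).
have Ei : elem Tt (fun y : V => (1 + sqnorm y)^-1) by exact: elemV.
rewrite (pd_Zl oT 2 i Ei)// (elem_pdV oT i Ed (dn0 y))//.
rewrite (elem_pdD oT i (elem_cst _ 1) (elem_sqnorm _))// pd_cst add0r pd_sqnorm /stf.
by move: (dn0 y) => h; field.
Qed.

Lemma pd_stX i k y : pd i (stX k) y = stf y * stE y i k.
Proof.
rewrite (elem_pdM oT i (elem_stf _) (elem_coord _ k))// pd_coord pd_stf mxE /stX.
by move: (i == k)%:R => b; ring.
Qed.

Lemma pd_stz i y : pd i stz y = stf y * stEz y i 0.
Proof.
rewrite (elem_pdB oT i (elem_stf _) (elem_cst _ 1))// pd_cst pd_stf mxE; ring.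
Qed.

Lemma pd_sqr (U : set V) f i y : open U -> elem U f -> U y ->
  pd i (fun y => f y ^+ 2) y = 2 * (f y * pd i f y).
Proof.
move=> oU Ef Uy; rewrite (pd_ext (g := fun y => f y * f y) i oU Uy) => [|z _]; last by rewrite expr2.
by rewrite (elem_pdM oU i Ef Ef Uy); move: (pd i f y) => b; ring.
Qed.

Lemma pd_vf i y : pd i vf y = - (2 * stf y * tvec y i).
Proof.
have Ex : elem Tt (fun y : V => stX i0 y ^+ 2) by apply: elemX; exact: elem_stX.
have Ez := elemM (elem_cst Tt (2 * d)) (elem_stz Tt).
rewrite (elem_pdD oT i (elemB (elem_cst Tt (1 + d ^+ 2)) Ex) Ez)//.
rewrite (elem_pdB oT i (elem_cst Tt _) Ex)// pd_cst (pd_Zl oT _ i (elem_stz Tt))//.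
rewrite (pd_sqr i oT (elem_stX Tt i0))// pd_stX pd_stz /tvec /uvec.
move: (stE y i i0) (stEz y i 0) => u w; ring.
Qed.

Lemma pd_Lp i y : vdom y -> pd i Lp y = 2^-1 * (Hp y * (stf y * tvec y i)).
Proof.
move=> vy; rewrite (elem_pd_powR open_vdom (- a) i (elem_vf vdom) vd vy) pd_vf /Hp.
by move: (vf y `^ _) (tvec y i) => b c; field.
Qed.

Lemma pd_Lf i y : vdom y -> pd i Lf y = - (2 * (Lp y * (stf y * tvec y i))).
Proof.
move=> vy; have Ev := elem_powR (1 - a) (elem_vf vdom) vd.
rewrite (elem_pdD open_vdom i (elem_cst _ C) (elemM (elem_cst _ (1 - a)^-1) Ev) vy) pd_cst add0r.
rewrite (pd_Zl open_vdom _ i Ev vy).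
rewrite (elem_pd_powR open_vdom (1 - a) i (elem_vf vdom) vd vy) pd_vf /Lp.
rewrite (_ : 1 - a - 1 = - a); last by ring.
by move: a1 (vf y `^ _) (tvec y i) => h b c; field.
Qed.

Lemma pd_lamf i y : vdom y -> pd i lamf y =
  stf y * (Hp y * tvec y i * (stX i0 y ^+ 2 - d * stz y) + 2 * Lp y * stX i0 y * uvec y i).
Proof.
move=> vy.
have E1 := elemM elem_Lp (EXdz vdom).
rewrite (elem_pdD open_vdom i elem_Lf (elemM (elem_cst _ 2) E1) vy).
rewrite (pd_Zl open_vdom _ i E1 vy) (elem_pdM open_vdom i elem_Lp (EXdz vdom) vy).
rewrite (pd_Lf i vy) (pd_Lp i vy).
have Ex U : elem U (fun y : V => stX i0 y ^+ 2) by apply: elemX; exact: elem_stX.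
rewrite (elem_pdB open_vdom i (Ex _) (elemM (elem_cst _ d) (elem_stz _)) vy).
rewrite (pd_sqr i open_vdom (elem_stX vdom i0) vy) (pd_Zl open_vdom _ i (elem_stz _) vy).
rewrite pd_stX pd_stz /tvec -/(uvec y i).
move: (uvec y i) (stEz y i 0) (Lp y) (Hp y) (stX i0 y) (stz y) (stf y) => u w l h x z f.
by field.
Qed.

(** As the frame is orthonormal, stE^T stE is a block of the projection onto the tangent space, the
    identity minus the square of the position vector. The contractions below rest on the same
    fact. *)
Lemma sum_uE y k : \sum_l uvec y l * stE y l k = (k == i0)%:R - stX i0 y * stX k y.
Proof.
under eq_bigr => l _ do rewrite /uvec !mxE.
transitivity (\sum_l ((l == i0)%:R * ((l == k)%:R - y 0 l * stX k y)
   - stX i0 y * ((l == k)%:R * y 0 l) + stX i0 y * stX k y * (y 0 l * y 0 l))).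
  by apply: eq_bigr => l _; ring.
have sd (f : 'I_n -> R) m : \sum_j (j == m)%:R * f j = f m.
  rewrite (bigD1 m)//= eqxx mul1r big1 ?addr0// => j jm.
  by rewrite (negbTE jm) mul0r.
rewrite big_split sumrB /= -!mulr_sumr !sd sum_sqr (eq_sym i0).
rewrite /stX /stf; move: (dn0 y) (k == i0)%:R => h b; by field.
Qed.

Lemma sum_wE y k : \sum_l stEz y l 0 * stE y l k = - (stz y * stX k y).
Proof.
under eq_bigr => l _ do rewrite !mxE.
transitivity (\sum_l (- (stf y) * ((l == k)%:R * y 0 l) + stf y * stX k y * (y 0 l * y 0 l))).
  by apply: eq_bigr => l _; ring.
have sd (f : 'I_n -> R) m : \sum_j (j == m)%:R * f j = f m.
  rewrite (bigD1 m)//= eqxx mul1r big1 ?addr0// => j jm.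
  by rewrite (negbTE jm) mul0r.
rewrite big_split /= -!mulr_sumr !sd sum_sqr.
rewrite /stX /stz /stf; move: (dn0 y) => h; by field.
Qed.

Lemma sum_ww y : \sum_l stEz y l 0 * stEz y l 0 = 1 - stz y ^+ 2.
Proof.
under eq_bigr => l _ do rewrite !mxE.
transitivity (stf y ^+ 2 * \sum_l y 0 l * y 0 l).
  by rewrite mulr_sumr; apply: eq_bigr => l _; ring.
rewrite sum_sqr /stz /stf; move: (dn0 y) => h; by field.
Qed.

Lemma sum_uw y : \sum_l uvec y l * stEz y l 0 = - (stz y * stX i0 y).
Proof. by rewrite -sum_wE; apply: eq_bigr => l _; rewrite mulrC. Qed.

Lemma sum_uu y : \sum_l uvec y l * uvec y l = 1 - stX i0 y ^+ 2.
Proof. by rewrite [LHS]sum_uE eqxx expr2. Qed.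

Lemma sum_tE y k : \sum_l tvec y l * stE y l k =
  stX i0 y * ((k == i0)%:R - stX i0 y * stX k y) + d * (stz y * stX k y).
Proof.
transitivity (stX i0 y * \sum_l uvec y l * stE y l k - d * \sum_l stEz y l 0 * stE y l k).
  by rewrite !mulr_sumr -sumrB; apply: eq_bigr => l _; rewrite /tvec; ring.
by rewrite sum_uE sum_wE; ring.
Qed.

Lemma sum_tw y : \sum_l tvec y l * stEz y l 0 =
  - (stz y * stX i0 y ^+ 2) - d * (1 - stz y ^+ 2).
Proof.
transitivity (stX i0 y * \sum_l uvec y l * stEz y l 0 - d * \sum_l stEz y l 0 * stEz y l 0).
  by rewrite !mulr_sumr -sumrB; apply: eq_bigr => l _; rewrite /tvec; ring.
by rewrite sum_uw sum_ww; ring.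
Qed.

Lemma hess_mul y (w : 'I_n -> R) i : \sum_k hessA y i k * w k =
  lamf y * w i - Hp y * tvec y i * (\sum_k tvec y k * w k)
  - 2 * Lp y * uvec y i * (\sum_k uvec y k * w k).
Proof.
rewrite !mulr_sumr -[X in X - _ - _](_ : \sum_k lamf y * ((i == k)%:R * w k) = _).
  by rewrite -!sumrB; apply: eq_bigr => k _; rewrite mxE; ring.
rewrite -mulr_sumr; congr (_ * _).
rewrite (bigD1 i)//= eqxx mul1r big1 ?addr0// => j jm.
by rewrite eq_sym (negbTE jm) mul0r.
Qed.

(** [gradx] and [gradz] form the gradient of the degree-one extension, whose Hessian restricts to
    Hess tau + tau id on the tangent space; [stf] is the length of the coordinate vectors. *)
Lemma pd_gradx i k y : vdom y -> pd i (gradx k) y = stf y * (hessA y *m stE y) i k.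
Proof.
move=> vy; have E1 := elemM elem_Lp (elem_stX vdom i0).
rewrite (elem_pdB open_vdom i (elemM elem_lamf (elem_stX _ k)) (elemM (elem_cst _ _) E1) vy).
rewrite (elem_pdM open_vdom i elem_lamf (elem_stX _ k) vy) (pd_Zl open_vdom _ i E1 vy).
rewrite (elem_pdM open_vdom i elem_Lp (elem_stX _ i0) vy) (pd_lamf i vy) (pd_Lp i vy) !pd_stX.
rewrite [X in _ = _ * X]mxE (hess_mul y (fun l => stE y l k)) sum_tE sum_uE -/(uvec y i).
move: (k == i0)%:R (uvec y i) (tvec y i) (stE y i k) (Lp y) (Hp y) (stX i0 y) (stX k y) => b u t e l h x xk.
by field.
Qed.

Lemma pd_gradz i y : vdom y -> pd i gradz y = stf y * (hessA y *m stEz y) i 0.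
Proof.
move=> vy.
rewrite (elem_pdD open_vdom i (elemM elem_lamf (elem_stz _)) (elemM (elem_cst _ _) elem_Lp) vy).
rewrite (elem_pdM open_vdom i elem_lamf (elem_stz _) vy) (pd_Zl open_vdom _ i elem_Lp vy).
rewrite (pd_lamf i vy) (pd_Lp i vy) pd_stz.
rewrite [X in _ = _ * X]mxE (hess_mul y (fun l => stEz y l 0)) sum_tw sum_uw.
move: (uvec y i) (tvec y i) (stEz y i 0) (Lp y) (Hp y) (stX i0 y) (stz y) => u t e l h x z.
by field.
Qed.

(** Euler's relation: the Hessian of a function homogeneous of degree one kills the position vector.
    Here it follows from the orthogonality of the frame to that vector. It makes (X, z) normal to
    the hypersurface (G, gz). *)
Lemma stX_dgrad i y : vdom y ->
  \sum_k stX k y * pd i (gradx k) y = - (stz y * pd i gradz y).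
Proof.
move=> vy; rewrite (pd_gradz i vy).
under eq_bigr => k _ do rewrite (pd_gradx i k vy).
apply/eqP; rewrite -addr_eq0; apply/eqP.
transitivity (stf y * \sum_l hessA y i l * (\sum_k stX k y * stE y l k + stz y * stEz y l 0)).
  rewrite mulr_sumr; under [in RHS]eq_bigr => l _ do rewrite mulrDr mulrDr.
  rewrite big_split /=; congr (_ + _).
    rewrite [RHS](_ : _ = \sum_l \sum_k stf y * (hessA y i l * (stX k y * stE y l k))).
      rewrite exchange_big; apply: eq_bigr => k _ /=; rewrite mxE !mulr_sumr.
      by apply: eq_bigr => l _; ring.
    by apply: eq_bigr => l _; rewrite !mulr_sumr.
  by rewrite mxE !mulr_sumr; apply: eq_bigr => l _; ring.
by rewrite big1 ?mulr0// => l _; rewrite frame_tangent mulr0.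
Qed.

(** Written as xi^2 v plus a term of order d^2 that is nonnegative on the sphere. *)
Lemma sum_tt y : \sum_l tvec y l * tvec y l =
  stX i0 y ^+ 2 * vf y + d ^+ 2 * (1 - stX i0 y ^+ 2 - stz y ^+ 2).
Proof.
transitivity (stX i0 y * \sum_l tvec y l * stE y l i0 - d * \sum_l tvec y l * stEz y l 0).
  by rewrite !mulr_sumr -sumrB; apply: eq_bigr => l _; rewrite /tvec /uvec; ring.
by rewrite sum_tE sum_tw eqxx mulr1n /vf; ring.
Qed.

Lemma sum_tu y : \sum_l tvec y l * uvec y l =
  stX i0 y * (1 - stX i0 y ^+ 2) + d * (stz y * stX i0 y).
Proof. by rewrite [LHS]sum_tE eqxx mulr1n; ring. Qed.

Lemma hessAC y : (hessA y)^T = hessA y. Proof. exact: tr_rank2C. Qed.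

End Potential.

(** * Estimates in one variable *)

Section Bernoulli.
Variable R : realType.
Implicit Types a b x : R.

Lemma powR_ge_ln b x : 0 < x -> 1 + b * ln x <= x `^ b.
Proof. by move=> x0; rewrite /powR gt_eqF// expR_ge1Dx. Qed.

Lemma powRD_gt0 x a b : 0 < x -> x `^ (a + b) = x `^ a * x `^ b.
Proof. by move=> x0; apply: powRD; rewrite (gt_eqF x0) implybT. Qed.

(** The right side is the mean of x and 1 with weights b and 1 - b. After division by x^b, both
    terms are bounded below by exp y >= 1 + y, and the logarithms cancel. *)
Lemma bernoulli_le b x : 0 <= b -> b <= 1 -> 0 < x -> x `^ b <= 1 + b * (x - 1).
Proof.
move=> b0 b1 x0; have y0 : 0 < x `^ b by rewrite powR_gt0.
have e1 : x = x `^ b * x `^ (1 - b).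
  by rewrite -powRD_gt0// subrKC powRr1 ?ltW.
have e2 : 1 = x `^ b * x `^ (- b).
  by rewrite -powRD_gt0// subrr powRr0.
have h1 := powR_ge_ln (1 - b) x0; have h2 := powR_ge_ln (- b) x0.
have -> : 1 + b * (x - 1) = b * x + (1 - b) * 1 by ring.
rewrite {2}e1 {3}e2.
have -> : b * (x `^ b * x `^ (1 - b)) + (1 - b) * (x `^ b * x `^ (- b)) =
  x `^ b * (b * x `^ (1 - b) + (1 - b) * x `^ (- b)) by ring.
rewrite -[X in X <= _]mulr1 ler_pM2l//.
have : b * (1 + (1 - b) * ln x) + (1 - b) * (1 + - b * ln x) <=
  b * x `^ (1 - b) + (1 - b) * x `^ (- b).
  by apply: lerD; apply: ler_wpM2l => //; lra.
by apply: le_trans; rewrite le_eqVlt; apply/orP; left; apply/eqP; ring.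
Qed.

(** The previous inequality with exponent 1 / a, at the point x^a. *)
Lemma bernoulli_ge a x : 1 <= a -> 0 < x -> 1 + a * (x - 1) <= x `^ a.
Proof.
move=> a1 x0; have a0 : 0 < a by lra.
have X0 : 0 < x `^ a by rewrite powR_gt0.
have := @bernoulli_le a^-1 (x `^ a); rewrite invr_ge0 ltW// invf_le1// => /(_ isT a1 X0).
rewrite -powRrM divff ?gt_eqF// (powRr1 (ltW x0)) => h.
have : a * x <= a * (1 + a^-1 * (x `^ a - 1)) by rewrite ler_pM2l.
by rewrite mulrDr mulrA divff ?gt_eqF// => ?; lra.
Qed.

End Bernoulli.

(** * The admissible window for l in the limit d = 0 *)

Section OneVariable.
Variables (R : realType) (N th : R).
Hypothesis N3 : 3 <= N.
Hypothesis thE : th = (16 * (N + 1))^-1.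
Let a := N / 4 + th.
Let r := a - 1.
Hypothesis r0 : r != 0.
(** Chosen so that, once the slope of the tangent to [Dq] at [w] is replaced by a rational bound,
    the estimate in [Dq_le] is constant in t up to the small slope 4 a - N = 4 th. *)
Let w := (N - 1) / (N + 1).

(** Concave, and zero at t = 1 and in the limit t -> 0, whatever the sign of a - 1. Both edges of
    the window are affine in t up to a multiple of [Dq]. *)
Definition Dq t := (t - t `^ a) / r.

Let h := (N + 1)^-1.
Let N1p : 0 < N + 1. Proof. by move: N3; lra. Qed.
Let N1m : 0 < N - 1. Proof. by move: N3; lra. Qed.
Let hN : h * (N + 1) = 1. Proof. by rewrite mulVf// gt_eqF. Qed.
Let h0 : 0 < h. Proof. by rewrite invr_gt0. Qed.
Let th16 : th = h / 16. Proof. by rewrite thE invfM mulrC. Qed.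
Let th0 : 0 < th. Proof. by rewrite th16 divr_gt0. Qed.
Let h4 : h <= 4^-1. Proof. by rewrite lef_pV2 ?posrE//; move: N3; lra. Qed.
Let w0 : 0 < w. Proof. by rewrite divr_gt0. Qed.
Let w1 : w <= 1. Proof. by rewrite ler_pdivrMr//; lra. Qed.
Let a0 : 3 / 4 < a. Proof. by move: N3 th0; rewrite /a; lra. Qed.
Local Ltac facts := move: h0 h4 th16 th0 w0 w1 a0 N1p N1m N3 => ? ? ? ? ? ? ? ? ? ?.
Let powS t : 0 < t -> t `^ a = t * t `^ r.
Proof. facts. by move=> t0; rewrite mulr_powRB1 ?ltW//; lra. Qed.

Lemma Dq_ge0 t : 0 < t -> t <= 1 -> 0 <= Dq t.
Proof. facts.
move=> t0 t1; have t01 : 0 < t <= 1 by rewrite t0.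
rewrite /Dq; have [rp|rn] := ltP 0 r.
  by rewrite divr_ge0 ?(ltW rp)// subr_ge0 ge1r_powR//; rewrite /r in rp; lra.
by rewrite mulr_le0 ?invr_le0// subr_le0 ger1_powR//; rewrite /r in rn; lra.
Qed.

Let s := (1 - w `^ r) / r.

Let s_ge0 : 0 <= s.
Proof.
have w01 : 0 < w <= 1 by rewrite w0.
rewrite /s; have [rp|rn] := ltP 0 r.
  by rewrite divr_ge0 ?(ltW rp)// subr_ge0 -(powRr0 w) ger_powR// ltW.
by rewrite mulr_le0 ?invr_le0// subr_le0 -{1}(powRr0 w) ger_powR.
Qed.

(** The slope of [Dq] at [w] is a s - 1; this makes it rational. For r > 0 it comes from 1 - w^r <=
    - r ln w, for r < 0 from Bernoulli's inequality at 1 / w. *)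
Let s_le : s <= w^-1 - 1.
Proof. facts.
have wi0 : 0 < w^-1 by rewrite invr_gt0.
rewrite /s; have [rp|rn] := ltP 0 r.
  rewrite ler_pdivrMr//.
  have l1 := powR_ge_ln r w0.
  have l2 : - ln w <= w^-1 - 1.
    by rewrite -lnV ?posrE// -[X in ln X](subrKC 1) le_ln1Dx// ltrBrDr addNr.
  have := ler_wpM2l (ltW rp) l2; lra.
have rN0 : 0 < - r by rewrite oppr_gt0 lt_neqAle r0.
have rN1 : - r <= 1 by rewrite /r; lra.
have e : w^-1 `^ (- r) = w `^ r.
  by rewrite -{1}(powR_inv1 (ltW w0)) -powRrM mulN1r opprK.
have := bernoulli_le (ltW rN0) rN1 wi0; rewrite e => l.
by rewrite ler_ndivrMr -?oppr_gt0//; lra.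
Qed.

(* Bernoulli's inequality at [t / w], that is, the tangent at [w] to the concave [Dq]. *)
Let tangent t : 0 < t -> Dq t <= w - t + s * (a * t - r * w).
Proof. facts.
move=> t0; have x0 : 0 < t / w by rewrite divr_gt0.
have sr : w `^ r = 1 - r * s by rewrite /s mulrC divfK// opprB addrC subrK.
have wa : w `^ a = w * (1 - r * s) by rewrite powS// sr.
have tE : t `^ a = (t / w) `^ a * w `^ a by rewrite -powRM ?(ltW x0) ?(ltW w0)// divfK// gt_eqF.
have wa0 : 0 <= w `^ a := powR_ge0 _ _.
have lin : (1 + a * (t / w - 1)) * w `^ a = (1 - r * s) * (w + a * (t - w)).
  rewrite wa; have := w0; rewrite lt0r => /andP[+ _]; move: (w) (s) => v u v0; by field.
have fin : (t - (1 - r * s) * (w + a * (t - w))) / r = w - t + s * (a * t - r * w).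
  by have := r0; rewrite /r; move: (a) (w) (s) => b v u b0; field.
rewrite -fin -lin /Dq tE; have [rp|rn] := ltP 0 r.
  rewrite ler_pM2r ?invr_gt0// lerD2l lerN2 ler_wpM2r// bernoulli_ge//.
  by rewrite /r in rp; lra.
rewrite ler_wnM2r ?invr_le0// lerD2l lerN2 ler_wpM2r// bernoulli_le//; rewrite /r in rn; lra.
Qed.

Let ww : w * (N + 2) = N - 2 * h.
Proof. by rewrite /w /h; field; rewrite gt_eqF. Qed.

(** The tangent at [w] with the rational bound on [s] works as long as the coefficient a t - r w of
    [s] is nonnegative; otherwise t is small and Dq t <= t / r is enough. *)
Lemma Dq_le t : 0 < t -> t <= 1 ->
  (N - 2) * t + 2 * (N - 1) * Dq t <= N - 2 * h + 4 * th.
Proof. facts.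
move=> t0 t1; have [c|c] := leP (r * w) (a * t).
  have D1 : Dq t <= 1 - 2 * a * h + t * (2 * a / (N - 1) - 1).
    apply: le_trans (tangent t0) _.
    have : s * (a * t - r * w) <= (w^-1 - 1) * (a * t - r * w).
      by rewrite ler_wpM2r// subr_ge0.
    have -> : 1 - 2 * a * h + t * (2 * a / (N - 1) - 1) =
      w - t + (w^-1 - 1) * (a * t - r * w).
      by rewrite /w /h /r; move: (a) => b; field; rewrite !gt_eqF.
    by lra.
  have N1 : 0 <= 2 * (N - 1) by lra.
  have := ler_wpM2l N1 D1.
  have -> : 2 * (N - 1) * (1 - 2 * a * h + t * (2 * a / (N - 1) - 1)) =
    N - 2 * h - (N - 2) * t + 4 * th * (t - (N - 1) * h).
    by rewrite /a /h; field; rewrite !gt_eqF.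
  have : 0 <= 4 * th * (1 - t + (N - 1) * h).
    apply: mulr_ge0; first lra.
    by apply: addr_ge0; [lra|apply: mulr_ge0; lra].
  move: (Dq t) => D; lra.
have rp : 0 < r.
  rewrite -(pmulr_lgt0 _ w0); apply: lt_trans c; apply: mulr_gt0 => //; lra.
have D1 : Dq t <= t / r.
  by rewrite /Dq ler_pM2r ?invr_gt0// lerBlDr lerDl powR_ge0.
have aw : t <= r * w / a by rewrite ler_pdivlMr 1?mulrC ?ltW//; lra.
have N1 : 0 <= 2 * (N - 1) by lra.
have := ler_wpM2l N1 D1.
have c0 : 0 <= N - 2 + 2 * (N - 1) / r by apply: addr_ge0; [lra|apply: divr_ge0; [lra|exact: ltW]].
have := ler_wpM2l c0 aw.
(* As N <= 4 a, this is at most w (N + 2) = N - 2 h. *)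
have -> : (N - 2 + 2 * (N - 1) / r) * (r * w / a) = w * (N - 2) + w * (N / a).
  have a00 : a != 0 by rewrite gt_eqF//; lra.
  have := r0; rewrite /r; move: a00; move: (a) (w) => b v b0 b1; by field; rewrite b0 b1.
have : w * (N / a) <= w * 4.
  apply: ler_wpM2l; first exact: ltW.
  by rewrite ler_pdivrMr; rewrite /a; lra.
have -> : 2 * (N - 1) * (t / r) = 2 * (N - 1) / r * t by ring.
have := ww; move: (Dq t) (2 * (N - 1) / r) (w * (N / a)) (w) => D q v vv; lra.
Qed.

Let N1 := 2 * a - 1.
(* Limits for d -> 0 of v^a lam and of 4 a xi^2 + 2 (1 - xi^2), as functions of t = v. *)
Definition ell0 t := (2 / N * ((2 - 2 * th) * N1 / r)) * t `^ a + 2 - 2 * t - t / r.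
Definition em0 t := 4 * a - (4 * a - 2) * t.

Let Nn0 : N != 0. Proof. by rewrite gt_eqF//; move: N3; lra. Qed.

(** The constant in [ell0] is fixed by asking for the same slack 4 th = 4 a - N at t = 0 and at t =
    1; in between, [Dq] only adds to it. *)
Lemma em0_ell0 t : 0 < t -> t <= 1 -> 4 * th <= em0 t - N / 2 * ell0 t.
Proof.
facts; move=> t0 t1.
have -> : em0 t - N / 2 * ell0 t = 4 * th + (2 - 2 * th) * N1 * Dq t.
  have thE' : th = a - N / 4 by rewrite /a; ring.
  rewrite /em0 /ell0 /Dq /N1; have := r0; have := Nn0; rewrite thE' /r.
  by move: (a) (t `^ a) => b u h1 h2; field; rewrite h1 h2.
by rewrite lerDl mulr_ge0 ?Dq_ge0// mulr_ge0//; rewrite /N1; lra.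
Qed.

(** This edge of the window needs an upper bound on [Dq]; the slack comes from the term - 2 h in
    [Dq_le]. *)
Lemma ell0_em0 t : 0 < t -> t <= 1 -> h / 12 <= (N - 1) * ell0 t - em0 t.
Proof.
facts; move=> t0 t1; have D0 := Dq_ge0 t0 t1; have D1 := Dq_le t0 t1.
have -> : (N - 1) * ell0 t - em0 t = N - 2 - 4 * th - 2 * N1 * (N - 2) / N * t
   - 4 * N1 * (N - 1) * (1 - th) / N * Dq t.
  have thE' : th = a - N / 4 by rewrite /a; ring.
  rewrite /em0 /ell0 /Dq /N1; have := r0; have := Nn0; rewrite thE' /r.
  by move: (a) (t `^ a) => b u h1 h2; field; rewrite h1 h2.
have Np : 0 < N by lra.
have n1 : 0 <= 2 * N1 / N by rewrite divr_ge0// /N1; lra.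
have := ler_wpM2l n1 D1.
have : 0 <= 4 * N1 * (N - 1) * th / N * Dq t.
  have N1p' : 0 < N1 by rewrite /N1; lra.
  apply: mulr_ge0 => //; apply: divr_ge0; last exact: ltW.
  by rewrite ltW// !mulr_gt0.
have -> : 4 * N1 * (N - 1) * (1 - th) / N * Dq t =
  2 * N1 / N * (2 * (N - 1) * Dq t) - 4 * N1 * (N - 1) * th / N * Dq t.
  by move: N1 (Dq t) => b D; ring.
have -> : 2 * N1 * (N - 2) / N * t = 2 * N1 / N * ((N - 2) * t) by ring.
have -> : 2 * N1 / N * ((N - 2) * t + 2 * (N - 1) * Dq t) =
  2 * N1 / N * ((N - 2) * t) + 2 * N1 / N * (2 * (N - 1) * Dq t) by ring.
(* With th = h / 16 and (N - 2) / N >= 1 / 3, the right side is at least (7 / 4) h / 3 - h / 2 = h /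
   12. *)
have : h / 12 <= N - 2 - 4 * th - 2 * N1 / N * (N - 2 * h + 4 * th).
  have e1 : 2 * N1 = N - 2 + 4 * th by rewrite /N1 /a; field.
  have -> : N - 2 - 4 * th - 2 * N1 / N * (N - 2 * h + 4 * th) =
    (N - 2 + 4 * th) * (2 * h - 4 * th) / N - 8 * th.
    by rewrite e1; field.
  rewrite th16 lerBrDr ler_pdivlMr//.
  by have := hN; nra.
move: (2 * N1 / N * (N - 2 * h + 4 * th)) (2 * N1 / N * ((N - 2) * t)) => T1 T2.
by move: (2 * N1 / N * (2 * (N - 1) * Dq t)) (4 * N1 * (N - 1) * th / N * Dq t) => T3 T4; lra.
Qed.

End OneVariable.

(** * Choice of a, d and C *)

Section Estimate.
Variable R : realType.

(* [pv] stands for v^a, and [l] for v^a lam. *)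
Lemma reduced_sigma2 (N a l v pv x z d : R) :
  v = 1 + d ^+ 2 - x ^+ 2 + 2 * d * z -> v != 0 -> pv != 0 ->
  let lam := l / pv in let p := 4 * a / (pv * v) in let q := 2 / pv in
  let tt := x ^+ 2 * v + d ^+ 2 * (1 - x ^+ 2 - z ^+ 2) in
  let uu := 1 - x ^+ 2 in
  let tu := x * (1 - x ^+ 2) + d * (z * x) in
  let Q := d ^+ 2 * (1 - x ^+ 2 - z ^+ 2) / v in
  N * lam ^+ 2 - 2 * lam * (p * tt + q * uu) + p ^+ 2 * tt ^+ 2 + q ^+ 2 * uu ^+ 2
    + 2 * p * q * tu ^+ 2 - (N * lam - p * tt - q * uu) ^+ 2 =
  (pv ^+ 2)^-1 * ((N - 1) * l * (2 * (4 * a * x ^+ 2 + 2 * uu) - N * l)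
    + 8 * a * Q * ((N - 1) * l - 2)).
Proof.
move=> vE v0 pv0 lam p q tt uu tu Q.
have key : tu ^+ 2 = tt * uu - Q * v.
  by rewrite /tu /tt /uu /Q divfK// vE; ring.
have ttE : tt = v * (x ^+ 2 + Q) by rewrite /tt /Q; field.
rewrite key ttE /lam /p /q {key ttE}; move: (Q) (uu) => Q' u'.
by field; rewrite v0 pv0.
Qed.

(** [e] and [m] are the limits for d -> 0 of [l] and [M], with errors at most [B] and [A]; the slack
    of the window absorbs them. *)
Lemma perturbed_bounds (N e m l M A B h : R) :
  3 <= N -> 0 <= A -> 0 <= B -> 0 < h -> A + N * B < h / 12 ->
  l <= e + B -> e - B <= l -> M <= m + A -> m - A <= M ->
  h / 4 <= m - N / 2 * e -> h / 12 <= (N - 1) * e - m ->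
  N * l < 2 * M /\ M < (N - 1) * l.
Proof.
move=> N3 A0 B0 h0 AB l1 l2 M1 M2 h1 h2.
have N0 : 0 <= N by lra.
have N1 : 0 <= N - 1 by lra.
have := ler_wpM2l N0 l1; have := ler_wpM2l N1 l2; have := mulr_ge0 N0 B0.
by move=> ? ? ?; split; lra.
Qed.

Lemma potential_estimate (n : nat) : (3 <= n)%N ->
  exists a d C : R, 1 - a != 0 /\
  forall x z : R, 0 <= z -> x ^+ 2 + z ^+ 2 <= 1 ->
  let v := 1 + d ^+ 2 - x ^+ 2 + 2 * d * z in
  let lp := v `^ (- a) in
  let lam := C + (1 - a)^-1 * v `^ (1 - a) + 2 * (lp * (x ^+ 2 - d * z)) in
  let p := 4 * a * v `^ (- a - 1) in let q := 2 * lp in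
  let tt := x ^+ 2 * v + d ^+ 2 * (1 - x ^+ 2 - z ^+ 2) in
  let uu := 1 - x ^+ 2 in
  let tu := x * (1 - x ^+ 2) + d * (z * x) in
  [/\ 0 < v,
    (n%:R * lam - p * tt - q * uu) ^+ 2 <
    n%:R * lam ^+ 2 - 2 * lam * (p * tt + q * uu) + p ^+ 2 * tt ^+ 2 + q ^+ 2 * uu ^+ 2
    + 2 * p * q * tu ^+ 2 &
    z = 0 -> 0 < (n%:R - 1) * lam - p * (tt - d ^+ 2) - q * uu].
Proof.
move=> n3; set N : R := n%:R.
have N3 : 3 <= N by rewrite ler_nat.
pose h := (N + 1)^-1; pose th := (16 * (N + 1))^-1.
have thE : th = (16 * (N + 1))^-1 by [].
have N1p : 0 < N + 1 by lra.
have h0 : 0 < h by rewrite invr_gt0.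
have th16 : th = h / 16 by rewrite thE invfM mulrC.
pose a := N / 4 + th; pose r := a - 1.
have a34 : 3 / 4 < a by rewrite /a th16; lra.
have r0 : r != 0.
  have [n4|n4] := leqP 4 n.
    have N4 : 4 <= N by rewrite /N (ler_nat R 4).
    by rewrite gt_eqF// /r /a th16; lra.
  have N3' : N = 3 by rewrite /N; congr (_%:R); apply/eqP; rewrite eqn_leq n3 -ltnS n4.
  have hE : h = 4^-1 by rewrite /h N3'; congr (_^-1); ring.
  by rewrite lt_eqF// /r /a th16 hE N3'; lra.
have a1 : 1 - a != 0 by rewrite -opprB oppr_eq0.
pose kk := `|2 + r^-1|.
have a2 : 0 <= 4 * a - 2 by lra.
have kk0 : 0 <= kk by exact: normr_ge0.
(* The limits [em0] and [ell0] are missed by at most 3 (4 a - 2) d and (4 + 3 kk) d. The choice of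
   [d] keeps the weighted sum K d of these errors below the slack h / 12. *)
pose K := 3 * (4 * a - 2) + N * (4 + 3 * kk).
have Nk0 : 0 <= N * kk by apply: mulr_ge0 => //; lra.
have K0 : 0 < K by rewrite /K; lra.
pose d := h / 12 / (K + 1).
have d0 : 0 < d by rewrite /d !divr_gt0//; lra.
have Kd : K * d < h / 12.
  rewrite /d mulrCA -[X in _ < X]mulr1 ltr_pM2l ?divr_gt0// ltr_pdivrMr; lra.
have h4 : h <= 4^-1 by rewrite lef_pV2 ?posrE//; lra.
have d1 : d <= 1.
  rewrite /d ler_pdivrMr; lra.
(* The largest value of v, taken at the pole z = 1; dividing by it gives t <= 1. *)
pose VV := (1 + d) ^+ 2.
have VV0 : 0 < VV by rewrite exprn_gt0//; lra.
pose c0 := 2 / N * ((2 - 2 * th) * (2 * a - 1) / r).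
(* With this constant v^a C = c0 t^a for t = v / VV, so that v^a lam is close to [ell0] at t. *)
exists a, d, (c0 * VV `^ (- a)); split=> // x z z0 xz v lp lam p q tt uu tu.
have x0 : 0 <= x ^+ 2 := sqr_ge0 x.
have zz0 : 0 <= z ^+ 2 := sqr_ge0 z.
have z1 : z <= 1 by nra.
have dz0 : 0 <= d * z by apply: mulr_ge0 => //; exact: ltW.
have dz1 : d * z <= d by rewrite -[X in _ <= X]mulr1 ler_pM2l.
have dd0 : 0 < d ^+ 2 by rewrite exprn_gt0.
have dd1 : d ^+ 2 <= d by rewrite expr2 -[X in _ <= X]mulr1 ler_pM2l.
have v0 : 0 < v by rewrite /v; lra.
have vVV : v <= VV by rewrite /v /VV sqrrD !expr2 in dd0 *; nra.
pose t := v / VV.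
have t0 : 0 < t by rewrite divr_gt0.
have t1 : t <= 1 by rewrite ler_pdivrMr// mul1r.
pose pv := v `^ a.
have pv0 : 0 < pv by rewrite powR_gt0.
pose l := c0 * t `^ a - v / r + 2 * (x ^+ 2 - d * z).
have tE : t `^ a = VV `^ (- a) * pv.
  rewrite /pv /t powRM ?invr_ge0 ?ltW//.
  by rewrite -(powR_inv1 (ltW VV0)) -powRrM mulN1r mulrC.
have lamE : lam = l / pv.
  have vm : v `^ (- a) = pv^-1 by rewrite powRN.
  have v1 : v `^ (1 - a) = v / pv by rewrite powRD_gt0// vm powRr1// ltW.
  rewrite /lam /lp /l tE vm v1.
  have -> : (1 - a)^-1 = - r^-1 by rewrite -invrN opprB.
  have : pv != 0 by rewrite gt_eqF.
  move: (VV `^ _) (c0) (pv) (r^-1) (v) => V c u ri w h2; by field.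
have pE : p = 4 * a / (pv * v).
  by rewrite /p powRD_gt0// powRN -/pv powR_inv1 ?ltW// -invfM.
have qE : q = 2 / pv by rewrite /q /lp powRN.
pose MM := 4 * a * x ^+ 2 + 2 * uu.
have vt : v - t = t * (2 * d + d ^+ 2).
  have -> : v = t * VV by rewrite /t divfK// gt_eqF.
  by rewrite /VV; ring.
have vt0 : 0 <= v - t.
  by rewrite vt mulr_ge0 ?(ltW t0)// addr_ge0 ?(ltW dd0)// mulr_ge0// ltW.
have vt1 : v - t <= 3 * d.
  rewrite vt -[X in _ <= X]mul1r; apply: ler_pM => //; first exact: ltW.
    by rewrite addr_ge0 ?(ltW dd0)// mulr_ge0// ltW.
  by move: dd1; move: (d ^+ 2) (d) => e f; lra.
have lE : l = ell0 N th t + 2 * (d ^+ 2 + d * z) - (2 + r^-1) * (v - t).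
  rewrite /l /ell0 /= -/a -/r -/c0; have -> : x ^+ 2 = 1 + d ^+ 2 + 2 * d * z - v by rewrite /v; ring.
  by move: (r^-1) (t `^ a) (c0) (t) (v) => ri ct c t' w; ring.
have kv : `|(2 + r^-1) * (v - t)| <= kk * (3 * d).
  by rewrite normrM; apply: ler_pM => //; rewrite ger0_norm.
have lb1 : l <= ell0 N th t + 4 * d + kk * (3 * d).
  have := ler_norm (- ((2 + r^-1) * (v - t))); rewrite normrN => ?; rewrite lE; lra.
have lb2 : ell0 N th t - kk * (3 * d) <= l.
  have := ler_norm ((2 + r^-1) * (v - t)) => ?; rewrite lE; lra.
have uE : uu = v - 2 * (d * z) - d ^+ 2 by rewrite /uu /v; ring.
have mE : MM = em0 N th t - (4 * a - 2) * (uu - t).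
  by rewrite /MM /em0 /= -/a /uu; ring.
have [ut1 ut2] : uu - t <= 3 * d /\ - (3 * d) <= uu - t.
  move: vt0 vt1 dz0 dz1 dd0 dd1; rewrite uE; move: (v) (t) (d * z) (d ^+ 2) => v' t' e f.
  by clear; split; lra.
have mb1 : MM <= em0 N th t + (4 * a - 2) * (3 * d).
  by rewrite mE; have := ler_wpM2l a2 ut2; lra.
have mb2 : em0 N th t - (4 * a - 2) * (3 * d) <= MM.
  by rewrite mE; have := ler_wpM2l a2 ut1; lra.
have Kd' : (4 * a - 2) * (3 * d) + N * (4 * d + kk * (3 * d)) < h / 12.
  by apply: le_lt_trans Kd; rewrite /K le_eqVlt; apply/orP; left; apply/eqP; ring.
have B1 := em0_ell0 N3 thE r0 t0 t1.
have B2 : h / 12 <= (N - 1) * ell0 N th t - em0 N th t := ell0_em0 N3 thE r0 t0 t1.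
have kd0 : 0 <= kk * (3 * d) by rewrite mulr_ge0// mulr_ge0// ltW.
have B1' : h / 4 <= em0 N th t - N / 2 * ell0 N th t.
  apply: le_trans B1; rewrite th16; move: (h) => h'; lra.
have [Hu Hl] : N * l < 2 * MM /\ MM < (N - 1) * l.
  apply: (perturbed_bounds N3 _ _ h0 Kd' _ _ mb1 mb2 B1' B2).
  - by rewrite mulr_ge0// mulr_ge0// ltW.
  - by rewrite addr_ge0// mulr_ge0// ltW.
  - by rewrite addrA.
  - by apply: le_trans lb2; rewrite lerD2l lerN2 lerDr mulr_ge0// ltW.
have uu1 : uu <= 1 by rewrite /uu lerBlDr lerDl.
have uu0 : 0 <= uu by rewrite /uu subr_ge0 (le_trans _ xz)// lerDl.
have aa0 : 0 <= 4 * a by rewrite mulr_ge0// (le_trans _ (ltW a34))// divr_ge0.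
have MM2 : 2 <= MM.
  rewrite /MM; have -> : x ^+ 2 = 1 - uu by rewrite /uu; ring.
  have : 0 <= (4 * a - 2) * (1 - uu) by rewrite mulr_ge0// subr_ge0.
  by move: (uu) (a) => u b; lra.
have pv_neq0 : pv != 0 by rewrite gt_eqF.
have v_neq0 : v != 0 by rewrite gt_eqF.
split=> //.
- rewrite -subr_gt0 lamE pE qE.
  have := @reduced_sigma2 N a l v pv x z d erefl v_neq0 pv_neq0.
  rewrite /= -/tt -/uu -/tu -/MM => ->.
  apply: mulr_gt0; first by rewrite invr_gt0 exprn_gt0.
  (* The term in Q, due to d > 0, has the right sign because (N - 1) l > MM >= 2. *)
  apply: ltr_wpDr.
    apply: mulr_ge0; last by rewrite subr_ge0 (le_trans MM2)// ltW.
    apply: mulr_ge0; first by rewrite -[8]/((4 * 2)%:R) natrM -mulrA mulrCA mulr_ge0.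
    rewrite divr_ge0// ?(ltW v0)// mulr_ge0 ?(ltW dd0)//.
    by rewrite -addrA -opprD subr_ge0.
  apply: mulr_gt0; last by rewrite subr_gt0.
  exact: lt_trans (lt_le_trans (ltr0Sn R 1) MM2) Hl.
- move=> z00.
  have -> : (N - 1) * lam - p * (tt - d ^+ 2) - q * uu =
    ((N - 1) * l - 4 * a * x ^+ 2 * (uu / v) - 2 * uu) / pv.
    rewrite lamE pE qE.
    have -> : tt - d ^+ 2 = x ^+ 2 * uu by rewrite /tt /uu /v z00; ring.
    move: pv_neq0 v_neq0; move: (uu) (v) (pv) (l) => u w pw l' h1 h2.
    by field; rewrite h1 h2.
  (* As uu <= v, the numerator is at least (N - 1) l - MM. *)
  apply: divr_gt0 => //.
  have uv : uu / v <= 1 by rewrite ler_pdivrMr// mul1r uE -addrA -opprD lerBlDr lerDl addr_ge0 ?(ltW dd0)// mulr_ge0.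
  have ax : 0 <= 4 * a * x ^+ 2 by apply: mulr_ge0.
  by have := ler_wpM2l ax uv; rewrite /MM in Hl; lra.
Qed.

End Estimate.

(** * Choice of the parameter *)

Section MatrixLimits.
Context {R : realType} {T : Type} (F : set_system T) {FF : Filter F}.

Lemma cvg_bigsum (I : Type) (r : seq I) (f : I -> T -> R) (l : I -> R) :
  (forall i, f i @ F --> l i) -> (fun t => \sum_(i <- r) f i t) @ F --> \sum_(i <- r) l i.
Proof.
move=> fl; elim: r => [|i r IH].
  by rewrite big_nil; under eq_fun do rewrite big_nil; exact: cvg_cst.
by rewrite big_cons; under eq_fun do rewrite big_cons; exact: cvgD.
Qed.

Lemma cvg_bigprod (I : Type) (r : seq I) (f : I -> T -> R) (l : I -> R) :
  (forall i, f i @ F --> l i) -> (fun t => \prod_(i <- r) f i t) @ F --> \prod_(i <- r) l i.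
Proof.
move=> fl; elim: r => [|i r IH].
  by rewrite big_nil; under eq_fun do rewrite big_nil; exact: cvg_cst.
by rewrite big_cons; under eq_fun do rewrite big_cons; exact: cvgM.
Qed.

Definition mxcvg m n (M : T -> 'M[R]_(m, n)) (L : 'M[R]_(m, n)) :=
  forall i j, (fun t => M t i j) @ F --> L i j.

Lemma cvg_det n (M : T -> 'M[R]_n) L : mxcvg M L -> (fun t => \det (M t)) @ F --> \det L.
Proof.
move=> ML; apply: cvg_bigsum => s; apply: cvgM; first exact: cvg_cst.
by apply: cvg_bigprod => i; exact: ML.
Qed.

Lemma mxcvg_adj n (M : T -> 'M[R]_n) L : mxcvg M L -> mxcvg (fun t => \adj (M t)) (\adj L).
Proof.
move=> ML i j; rewrite mxE; under eq_fun do rewrite mxE.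
apply: cvgM; first exact: cvg_cst.
apply: cvg_det => k l; rewrite !mxE; under eq_fun do rewrite !mxE; exact: ML.
Qed.

Lemma mxcvg_mul m n p (A : T -> 'M[R]_(m, n)) (B : T -> 'M[R]_(n, p)) A0 B0 :
  mxcvg A A0 -> mxcvg B B0 -> mxcvg (fun t => A t *m B t) (A0 *m B0).
Proof.
move=> hA hB i j; rewrite mxE; under eq_fun do rewrite mxE.
by apply: cvg_bigsum => k; exact: cvgM.
Qed.

Lemma cvg_trace n (A : T -> 'M[R]_n) A0 : mxcvg A A0 -> (fun t => \tr (A t)) @ F --> \tr A0.
Proof. by move=> hA; apply: cvg_bigsum => i; exact: hA. Qed.

(** The inverse is replaced by the adjugate, which is polynomial and hence continuous; the factor
    det^-2 on both sides does not affect the inequality. *)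
Lemma near_sigma2 n (A : T -> 'M[R]_n) (A0 : 'M[R]_n) (s : T -> R) :
  mxcvg A A0 -> s @ F --> (0 : R) -> \tr A0 ^+ 2 < \tr (A0 *m A0) ->
  \forall t \near F, (1%:M - s t *: A t) \in unitmx /\
    let B := invmx (1%:M - s t *: A t) *m A t in \tr B ^+ 2 < \tr (B *m B).
Proof.
move=> hA hs lt0.
pose S t := 1%:M - s t *: A t.
have hS : mxcvg S 1%:M.
  move=> i j; rewrite -[X in _ --> X]subr0 -(mul0r (A0 i j)).
  have -> : (fun t => S t i j) = (fun t => (1%:M : 'M[R]_n) i j - s t * A t i j).
    by apply/funext => t; rewrite !mxE.
  by apply: cvgB; [exact: cvg_cst|exact: cvgM].
have hN : mxcvg (fun t => \adj (S t) *m A t) A0.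
  have := mxcvg_mul (mxcvg_adj hS) hA.
  by rewrite -[\adj 1%:M]mulmx1 mul_adj_mx det1 mul1mx.
have hd := cvg_det hS.
have h1 : \forall t \near F, \det (S t) != 0.
  by apply: (cvgr_neq0 _ hd); rewrite det1 oner_neq0.
have h2 : \forall t \near F, 0 < \tr ((\adj (S t) *m A t) *m (\adj (S t) *m A t)) -
     \tr (\adj (S t) *m A t) * \tr (\adj (S t) *m A t).
  have c1 := cvg_trace (mxcvg_mul hN hN); have c2 := cvg_trace hN.
  apply: (cvgr_gt _ (cvgB c1 (cvgM c2 c2))).
  by rewrite subr_gt0 -expr2.
near=> t.
have d0 : \det (S t) != 0 by near: t.
have Su : S t \in unitmx by rewrite unitmxE unitfE.
split => //=; rewrite -/(S t) /invmx Su -scalemxAl -scalemxAl -scalemxAr !mxtraceZ.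
rewrite exprMn mulrA -expr2 ltr_pM2l ?exprn_even_gt0 ?invr_eq0// expr2 -subr_gt0.
by near: t.
Unshelve. all: by end_near. Qed.

End MatrixLimits.

Section Ball.
Context {R : realType} {n : nat}.
Local Notation V := 'rV[R]_n.

Lemma compact_closed_ball1 : compact (@closed_ball1 R n).
Proof.
have c : compact [set v : V | forall i, v ord0 i \in `[(-1 : R), 1]].
  apply: (@rV_compact _ _ (fun=> `[(-1 : R), 1]%classic)) => _.
  exact: segment_compact.
apply: subclosed_compact c _ => [|v /= v1 i].
  have cs : continuous (@sqnorm R n).
    by move=> y; exact: (elem_continuous openT (elem_sqnorm setT)).
  have -> : @closed_ball1 R n = sqnorm @^-1` [set t : R | t <= 1] by [].
  by apply: closed_comp => [y _|]; [exact: cs|exact: closed_le].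
have vi : v 0 i ^+ 2 <= 1.
  apply: le_trans v1; rewrite /sqnorm (bigD1 i)//= lerDl.
  by apply: sumr_ge0 => k _; exact: sqr_ge0.
by rewrite in_itv /=; move: (v 0 i) vi => t t1; apply/andP; split; nra.
Qed.

End Ball.

Lemma defmC {R : realType} {n : nat} (X G : 'I_n -> 'rV[R]_n -> R) z gz eps i j y :
  defm X G z gz eps i j y = defm X G z gz eps j i y.
Proof.
by rewrite /defm; apply: f_equal2; [apply: eq_bigr => k _|]; exact: mulrC.
Qed.

Lemma quad_affine (R : realType) (n : nat) (w : 'rV[R]_n) (k c : R) (B : 'M[R]_n) :
  \sum_i \sum_j w 0 i * w 0 j * (k * (i == j)%:R + c * B i j) =
  k * sqnorm w + c * \sum_i \sum_j w 0 i * w 0 j * B i j.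
Proof.
rewrite /sqnorm !mulr_sumr -big_split; apply: eq_bigr => i _ /=.
under eq_bigr do rewrite mulrDr.
rewrite big_split /=; congr (_ + _); last first.
  by rewrite mulr_sumr; apply: eq_bigr => j _; rewrite mulrCA.
rewrite (bigD1 i)//= eqxx big1 ?addr0 => [|j ji]; last first.
  by rewrite eq_sym (negbTE ji) !mulr0.
by rewrite mulr1 mulrC expr2.
Qed.

(** * The metric on the hemisphere *)

Section Assembly.
Context {R : realType} {n : nat}.
Local Notation V := 'rV[R]_n.
Variables (i0 : 'I_n) (d a C : R).
Hypothesis a1 : 1 - a != 0.

Local Notation X := (@stX R n).
Local Notation z := (@stz R n).
Local Notation G := (gradx i0 d a C).
Local Notation gz := (gradz i0 d a C).
Local Notation A := (hessA i0 d a C).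
Local Notation vf := (vf i0 d).

Hypothesis vball : forall y : V, closed_ball1 y -> 0 < vf y.
Hypothesis sigma2 : forall y : V, closed_ball1 y -> \tr (A y) ^+ 2 < \tr (A y *m A y).
Hypothesis bdry : forall y : V, unit_sphere y ->
  0 < \tr (A y) - \sum_i \sum_j y 0 i * y 0 j * A y i j.

Definition gmetric eps := defm X G z gz eps.

Lemma elem_hessA i j : elem (vdom i0 d) (fun y => A y i j).
Proof.
have oU := @open_vdom R n i0 d.
have Ex U k : elem U (X k) := elem_stX U k.
have EE U k l : elem U (fun y => stE y k l).
  apply: (elem_ext (g := fun y => (k == l)%:R - y 0 k * stX l y)) => [|y _]; last by rewrite mxE.
  by apply: elemB; [exact: elem_cst|apply: elemM; [exact: elem_coord|exact: elem_stX]].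
have Ezz U k : elem U (fun y => stEz y k 0).
  apply: (elem_ext (g := fun y => - (stf y * y 0 k))) => [|y _]; last by rewrite mxE.
  by apply: elemN; apply: elemM; [exact: elem_stf|exact: elem_coord].
have Et U k : elem U (fun y => tvec i0 d y k).
  apply: elemB; first by apply: elemM; [exact: Ex|exact: EE].
  by apply: elemM; [exact: elem_cst|exact: Ezz].
have Eu U k : elem U (fun y => uvec i0 y k) by exact: EE.
have Eh : elem (vdom i0 d) (Hp i0 d a).
  apply: elemM; first exact: elem_cst.
  by apply: elem_powR => //; exact: elem_vf.
apply: (elem_ext (g := fun y => lamf i0 d a C y * (i == j)%:R
   - Hp i0 d a y * (tvec i0 d y i * tvec i0 d y j)
   - 2 * Lp i0 d a y * (uvec i0 y i * uvec i0 y j))) => [|y _]; last by rewrite mxE.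
apply: elemB; first apply: elemB.
- by apply: elemM; [exact: elem_lamf|exact: elem_cst].
- by apply: elemM => //; exact: elemM.
- apply: elemM; last exact: elemM.
  by apply: elemM; [exact: elem_cst|exact: elem_Lp].
Qed.

(** At eps = 0 the conditions reduce to [sigma2]. They persist for (y, eps) near each (y0, 0), and
    compactness of the ball gives one neighbourhood of 0 for all y. *)
Lemma small_eps : exists2 eps : R, 0 < eps & forall y : V, closed_ball1 y ->
  0 < 1 + eps * gz y /\
  let S := 1%:M - shr z gz eps y *: A y in
  S \in unitmx /\ let B := invmx S *m A y in \tr B ^+ 2 < \tr (B *m B).
Proof.
pose P eps y := 0 < 1 + eps * gz y /\
  let S := 1%:M - shr z gz eps y *: A y in
  S \in unitmx /\ let B := invmx S *m A y in \tr B ^+ 2 < \tr (B *m B).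
have oU := @open_vdom R n i0 d.
suff : \forall eps \near (0 : R), @closed_ball1 R n `<=` P eps.
  move=> /nbhs_ballP [e /= e0 He]; exists (e / 2); first by rewrite divr_gt0.
  apply: He; rewrite /ball /= sub0r normrN gtr0_norm ?divr_gt0//.
  by rewrite ltr_pdivrMr// ltr_pMr// ltr1n.
have cov := proj1 (compact_near_coveringP _) (@compact_closed_ball1 R n).
apply: (cov R (nbhs (0 : R)) P _) => y0 y0b.
have Uy0 : vdom i0 d y0 := vball y0b.
pose F := filter_prod (nbhs y0) (nbhs (0 : R)).
have c1 f : elem (vdom i0 d) f -> (fun t : V * R => f t.1) @ F --> f y0.
  move=> Ef; apply: (cvg_comp _ _ cvg_fst); exact: elem_continuous oU Ef Uy0.
have ce : (fun t : V * R => t.2) @ F --> (0 : R) by exact: cvg_snd.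
have cg : (fun t : V * R => 1 + t.2 * gz t.1) @ F --> (1 : R).
  rewrite -[X in _ --> X]addr0 -[X in _ --> _ + X](mul0r (gz y0)).
  apply: cvgD; first exact: cvg_cst.
  by apply: cvgM => //; apply: c1; exact: elem_gradz.
have cs : (fun t : V * R => shr z gz t.2 t.1) @ F --> (0 : R).
  rewrite -[X in _ --> X](mul0r (1^-1 * z y0)); apply: cvgM => //; apply: cvgM.
    by apply: cvgV => //; exact: oner_neq0.
  by apply: c1; exact: elem_stz.
have cA : mxcvg F (fun t : V * R => A t.1) (A y0).
  by move=> i j; apply: (c1 (fun y => A y i j)); exact: elem_hessA.
have h1 : \forall t \near F, 0 < 1 + t.2 * gz t.1 by exact: (cvgr_gt _ cg _ ltr01).
have FF : Filter F by exact: filter_prod_filter.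
have h2 := @near_sigma2 _ _ F FF _ _ _ _ cA cs (sigma2 y0b).
by apply: filterS2 h1 h2 => -[y e] /= p1 p2; split.
Qed.

Lemma gmetric_bdry eps (y : V) i j : unit_sphere y -> gmetric eps i j y = gbar i j y.
Proof.
move=> y1; have z0 : z y = 0.
  by rewrite /stz /stf y1; field.
have s0 : shr z gz eps y = 0 by rewrite /shr z0 !mulr0.
have f1 : stf y = 1 by move: z0; rewrite /stz => /eqP; rewrite subr_eq0 => /eqP.
have e1 l : frz z gz eps l y = stEz y l 0 by rewrite /frz s0 mul0r subr0 pd_stz f1 mul1r.
have e2 l k : frx X G z gz eps l k y = stE y l k.
  by rewrite /frx s0 mul0r subr0 pd_stX f1 mul1r.
have y1' : sqnorm y = 1 := y1.
transitivity ((1%:M : 'M[R]_n) i j); last first.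
  by rewrite mxE /gbar y1'; move: (i == j)%:R => e; field.
rewrite -(frame_gram y) mxE [X in _ = X + _]mxE [X in _ = _ + X]mxE big_ord1.
rewrite /gmetric /defm !e1; congr (_ + _); last by rewrite [_^T _ _]mxE.
by apply: eq_bigr => k _; rewrite !e2 [_^T _ _]mxE.
Qed.

(** The factor s is isolated so that, where s = 0, the metric can be differentiated without
    differentiating A. *)
Lemma gmetric_hess eps (y : V) i j : vdom i0 d y ->
  gmetric eps i j y = stf y ^+ 2 * ((i == j)%:R
    - shr z gz eps y * (2 * A y i j - shr z gz eps y * \sum_k A y i k * A y k j)).
Proof.
move=> Vy.
have := gmx_defm eps (frame_gram y) (fun i k => pd_stX i k y) (fun i => pd_stz i y)
  (fun i k => pd_gradx C a1 i k Vy) (fun i => pd_gradz C a1 i Vy) (hessAC i0 d a C y).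
move/matrixP => /(_ i j); rewrite mxE [RHS]mxE => e; rewrite /gmetric e; congr (_ * _).
rewrite /smx mulmxBl mul1mx mulmxBr mulmx1 -scalemxAl -scalemxAr !mxE.
move: (shr _ _ _ _) (\sum_k _) (A y i j) => s q b; ring.
Qed.

(** As s = 0 on the equator, only the derivatives of the conformal factor and of s contribute. Both
    are radial, since the differential of z is - y there. *)
Lemma pd_gmetric_bdry eps (U : set V) (y : V) m i j : open U -> U `<=` vdom i0 d ->
  (forall y, U y -> 1 + eps * gz y != 0) -> U y -> unit_sphere y ->
  pd m (gmetric eps i j) y =
  y 0 m * (-2 * (i == j)%:R + 2 * (eps * kap gz eps y) * A y i j).
Proof.
move=> oU sU k0 Uy y1.
have y1' : sqnorm y = 1 := y1.
have z0 : z y = 0 by rewrite /stz /stf y1'; field.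
have f1 : stf y = 1 by move: z0; rewrite /stz => /eqP; rewrite subr_eq0 => /eqP.
have s0 : shr z gz eps y = 0 by rewrite /shr z0 !mulr0.
have Ez : elem U z := elem_stz U.
have Eg : elem U gz := elem_subset sU (elem_gradz i0 d a C).
have Es : elem U (shr z gz eps) := elem_shr Ez Eg k0.
have EA k l : elem U (fun y => A y k l) := elem_subset sU (elem_hessA k l).
pose Q y' := 2 * A y' i j - shr z gz eps y' * \sum_k A y' i k * A y' k j.
have EQ : elem U Q.
  apply: elemB; first by apply: elemM; [exact: elem_cst|exact: EA].
  by apply: elemM => //; apply: elem_sum => k; apply: elemM; exact: EA.
have Ef : elem U (fun y => stf y ^+ 2) by apply: elemX; exact: elem_stf.
have ED : elem U (fun y => (i == j)%:R - shr z gz eps y * Q y).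
  by apply: elemB; [exact: elem_cst|exact: elemM].
rewrite (pd_ext m oU Uy (fun y Uy => gmetric_hess eps i j (sU y Uy))).
rewrite (elem_pdM oU m Ef ED Uy) (pd_sqr m oU (elem_stf U) Uy) pd_stf.
rewrite (elem_pdB oU m (elem_cst U _) (elemM Es EQ) Uy) pd_cst.
rewrite (elem_pdM oU m Es EQ Uy) (pd_shr oU Ez Eg k0 m Uy) s0 /frz s0 pd_stz f1 mxE f1.
rewrite /Q s0; move: (pd m _ _) (pd m _ _) (\sum_k _) (A y i j) (kap _ _ _) (y 0 m) => p p' q b c u.
by move: (i == j)%:R => e; ring.
Qed.

Lemma gmetric_good (eps : R) : 0 < eps ->
  (forall y : V, closed_ball1 y ->
  0 < 1 + eps * gz y /\
  let S := 1%:M - shr z gz eps y *: A y in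
  S \in unitmx /\ let B := invmx S *m A y in \tr B ^+ 2 < \tr (B *m B)) ->
  smooth_metric_on_closed_ball (gmetric eps) /\
  (forall y, closed_ball1 y -> n%:R * (n%:R - 1) < scal (gmetric eps) y) /\
  (forall y, unit_sphere y -> forall i j, gmetric eps i j y = gbar i j y) /\
  (forall y, unit_sphere y -> 0 < mean_curv (gmetric eps) y).
Proof.
move=> e0 He.
have oV := @open_vdom R n i0 d.
have Eg0 := elem_gradz i0 d a C.
pose U := vdom i0 d `&` [set y | 0 < 1 + eps * gz y].
have EK : elem (vdom i0 d) (fun y => 1 + eps * gz y).
  by apply: elemD; [exact: elem_cst|apply: elemM; [exact: elem_cst|]].
have oU : open U by exact: open_elem_gt0.
have sU : U `<=` vdom i0 d by move=> y [].
have bU : @closed_ball1 R n `<=` U.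
  by move=> y yb; split; [exact: vball|case: (He y yb)].
have EX k : elem U (X k) := elem_stX U k.
have EG k : elem U (G k) := elem_subset sU (elem_gradx i0 d a C k).
have Ez : elem U z := elem_stz U.
have Eg : elem U gz := elem_subset sU Eg0.
have XX y : U y -> \sum_k X k y * X k y = 1 - z y * z y by move=> _; exact: stX_sqr.
have XdG i y : U y -> \sum_k X k y * pd i (G k) y = - (z y * pd i gz y).
  by move=> /sU Vy; exact: stX_dgrad.
have k0 y : U y -> 1 + eps * gz y != 0 by move=> [_ /= h]; rewrite gt_eqF.
have Em i j : elem U (gmetric eps i j) by exact: elem_defm.
have fr y := frame_gram y.
split; [split; [|split]|split; [|split]].
- exists U; split=> //; split=> // i j; exact: elem_smooth.
- by move=> y _ i j; exact: defmC.
- move=> y yb v v0; have [_ /= [Su _]] := He y yb.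
  have Vy := vball yb.
  apply: (defm_posdef (f := stf y) (E := stE y) (Ez := stEz y) (A := A y)) => //.
  + by rewrite gt_eqF ?stf_gt0.
  + by move=> i k; exact: pd_stX.
  + by move=> i; exact: pd_stz.
  + by move=> i k; exact: pd_gradx.
  + by move=> i; exact: pd_gradz.
  + exact: hessAC.
- move=> y yb; have [_ /= [Su Bs]] := He y yb.
  have Vy := vball yb; have Uy := bU y yb.
  rewrite (scal_frame (f := stf y) (E := stE y) (Ez := stEz y) (A := A y) _ _ _ _ _ _ _
    oU Uy EX EG Ez Eg XX XdG k0) //.
  + rewrite ltrDl mulr_gt0// ?subr_gt0// exprn_gt0// mulr_gt0// invr_gt0.
    by case: Uy.
  + by rewrite gt_eqF ?stf_gt0.
  + by move=> i k; exact: pd_stX.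
  + by move=> i; exact: pd_stz.
  + by move=> i k; exact: pd_gradx.
  + by move=> i; exact: pd_gradz.
  + exact: hessAC.
- by move=> y y1 i j; exact: gmetric_bdry.
- move=> y y1.
  have yb : closed_ball1 y by rewrite /closed_ball1 /= y1.
  have Uy := bU y yb; have Vy := vball yb.
  have y1' : sqnorm y = 1 := y1.
  have z0 : z y = 0 by rewrite /stz /stf y1'; field.
  have f1 : stf y = 1 by move: z0; rewrite /stz => /eqP; rewrite subr_eq0 => /eqP.
  have s0 : shr z gz eps y = 0 by rewrite /shr z0 !mulr0.
  pose c := eps * kap gz eps y.
  have c0 : 0 < c by rewrite mulr_gt0// invr_gt0; case: Uy.
  pose M i j := -2 * (i == j)%:R + 2 * c * A y i j.
  have pdM m i j : pd m (gmetric eps i j) y = y 0 m * M i j.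
    exact: (pd_gmetric_bdry m i j oU sU k0 Uy y1).
  have MC i j : M i j = M j i.
    by rewrite /M eq_sym -{1}(hessAC i0 d a C y) mxE.
  have gd i j : gmetric eps i j y = (i == j)%:R.
    by rewrite gmetric_bdry// /gbar y1'; move: (i == j)%:R => e; field.
  rewrite (mean_curv_unit_sphere oU Em Uy y1' gd pdM MC).
  have -> : \sum_i M i i = - (2 * n%:R) + 2 * c * \tr (A y).
    rewrite /M big_split /= -!mulr_sumr -/(mxtrace (A y)); congr (_ + _).
    rewrite (eq_bigr (fun=> 1)) => [|i _]; last by rewrite eqxx.
    by rewrite sumr_const card_ord mulNr.
  rewrite [X in _ * (_ - X)](_ : _ = -2 + 2 * c * \sum_i \sum_j y 0 i * y 0 j * A y i j); last first.
    by have := quad_affine y (-2) (2 * c) (A y); rewrite y1' mulr1 => <-.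
  have b0 := bdry y1.
  move: (\tr (A y)) (\sum_i \sum_j _) b0 => t u b0.
  (* The Euclidean value n - 1 cancels against the conformal factor: the equator is totally geodesic
     for the round metric. *)
  have -> : n%:R - 1 + 2^-1 * (- (2 * n%:R) + 2 * c * t - (-2 + 2 * c * u)) = c * (t - u).
    by field.
  exact: mulr_gt0.
Qed.

End Assembly.

(** * The estimates on the ball, and the conclusion *)

Lemma stz_ge0 (R : realType) (n : nat) (y : 'rV[R]_n) : closed_ball1 y -> 0 <= stz y.
Proof.
move=> y1; rewrite /stz /stf subr_ge0 ler_pdivlMr ?denom_gt0// mul1r.
by rewrite -[2]/(1 + 1) lerD2l.
Qed.

Lemma stX_stz_le1 (R : realType) (n : nat) (i0 : 'I_n) (y : 'rV[R]_n) :
  stX i0 y ^+ 2 + stz y ^+ 2 <= 1.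
Proof.
rewrite -lerBrDr [in leRHS]expr2 -stX_sqr (bigD1 i0)//= expr2 lerDl.
by apply: sumr_ge0 => i _; rewrite -expr2 sqr_ge0.
Qed.

Section Contractions.
Context {R : realType} {n : nat}.
Variables (i0 : 'I_n) (d a C : R) (y : 'rV[R]_n).
Local Notation X := (stX i0 y).
Local Notation z := (stz y).
Local Notation tt := (X ^+ 2 * vf i0 d y + d ^+ 2 * (1 - X ^+ 2 - z ^+ 2)).
Local Notation A := (hessA i0 d a C y).
Local Notation lam := (lamf i0 d a C y).
Local Notation p := (Hp i0 d a y).
Local Notation q := (2 * Lp i0 d a y).

Lemma tr_hessA : \tr A = n%:R * lam - p * tt - q * (1 - X ^+ 2).
Proof. by rewrite tr_rank2 sum_tt sum_uu. Qed.

Lemma tr_hessA_sqr : \tr (A *m A) =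
  n%:R * lam ^+ 2 - 2 * lam * (p * tt + q * (1 - X ^+ 2)) + p ^+ 2 * tt ^+ 2
  + q ^+ 2 * (1 - X ^+ 2) ^+ 2
  + 2 * p * q * (X * (1 - X ^+ 2) + d * (z * X)) ^+ 2.
Proof. by rewrite tr_rank2_sqr sum_tt sum_uu sum_tu. Qed.

(** On the equator the outward unit normal is [y]. The gradient [uvec] of xi is tangent to the
    equator, and [tvec] has normal component d. *)
Lemma quad_hessA : unit_sphere y ->
  \sum_i \sum_j y 0 i * y 0 j * A i j = lam - p * d ^+ 2.
Proof.
move=> y1; have z0 : z = 0 by rewrite /stz /stf y1; field.
have wE l : stEz y l 0 = - y 0 l.
  by rewrite mxE; move: z0; rewrite /stz => /subr0_eq ->; rewrite mul1r.
have ny f : \sum_l f l * y 0 l = - \sum_l f l * stEz y l 0.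
  by rewrite -sumrN; apply: eq_bigr => l _; rewrite wE mulrN opprK.
have tw : \sum_l tvec i0 d y l * y 0 l = d.
  by rewrite ny sum_tw z0; ring.
have uw : \sum_l uvec i0 y l * y 0 l = 0 by rewrite ny sum_uw z0 mul0r !oppr0.
have := quad_rank2 lam p q (tvec i0 d y) (uvec i0 y) (y 0).
rewrite tw uw sum_sqr y1 mulr1 expr0n mulr0 subr0 => <-.
rewrite exchange_big; apply: eq_bigr => i _; rewrite mulr_sumr.
by apply: eq_bigr => j _; rewrite mulrA (mulrC (y 0 j)).
Qed.
End Contractions.

Theorem theorem1p4 (R : realType) (n : nat) (hn : (3 <= n)%N) :
  exists g : @metric_field R n,
    smooth_metric_on_closed_ball g /\
    (forall y, closed_ball1 y -> n%:R * (n%:R - 1) < scal g y) /\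
    (forall y, unit_sphere y -> forall i j, g i j y = gbar i j y) /\
    (forall y, unit_sphere y -> 0 < mean_curv g y).
Proof.
have [a [d [C [a1 est]]]] := @potential_estimate R n hn.
pose i0 : 'I_n := Ordinal (leq_trans (isT : (0 < 3)%N) hn).
have est_at (y : 'rV[R]_n) (yb : closed_ball1 y) :=
  est (stX i0 y) (stz y) (stz_ge0 yb) (stX_stz_le1 i0 y).
have vball (y : 'rV[R]_n) : closed_ball1 y -> 0 < vf i0 d y.
  by move=> yb; have [] := est_at y yb.
have sigma2 (y : 'rV[R]_n) : closed_ball1 y ->
    \tr (hessA i0 d a C y) ^+ 2 < \tr (hessA i0 d a C y *m hessA i0 d a C y).
  move=> yb; have [_ + _] := est_at y yb.
  by rewrite tr_hessA tr_hessA_sqr.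
have bdry (y : 'rV[R]_n) : unit_sphere y -> 0 < \tr (hessA i0 d a C y)
    - \sum_i \sum_j y 0 i * y 0 j * hessA i0 d a C y i j.
  move=> y1; have yb : closed_ball1 y by rewrite /closed_ball1 /= y1.
  have [_ _] := est_at y yb.
  have z0 : stz y = 0 by rewrite /stz /stf y1; field.
  move=> /(_ z0); rewrite tr_hessA quad_hessA//.
  rewrite -/(vf i0 d y) -/(Lf i0 d a C y) -/(Lp i0 d a y) -/(lamf i0 d a C y) -/(Hp i0 d a y).
  move: (lamf _ _ _ _ _) (Hp _ _ _ _) (Lp _ _ _ _) (vf _ _ _) => l p q v.
  by congr (0 < _); ring.
have [eps eps0 He] := small_eps vball sigma2.
by exists (gmetric i0 d a C eps); exact: gmetric_good.
Qed.
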